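(* Let $L$ be a valid lattice and $K$ a Kasteleyn matrix for $\mathbb{T}_L$. Let $p_K(q_0,q_1)$ be the Laurent polynomial given by $\det(K)$. Then there is a choice of constants $s_{00},s_{01},s_{10},s_{11}\in\{\frac12,-\frac12\}$ such that the total number of tilings of $\mathbb{T}_L$ is $$s_{00}\,p_K(1,1)+s_{01}\,p_K(1,-1)+s_{10}\,p_K(-1,1)+s_{11}\,p_K(-1,-1).$$
   Context: Tilings: the unit square $[i,i+1]\times[j,j+1]$ ($i,j\in\mathbb{Z}$) is black if $i+j$ is even and white otherwise. A domino is the union of two unit squares sharing a side; a tiling of $\mathbb{Z}^2$ is a set of dominoes with pairwise disjoint interiors covering $\mathbb{R}^2$. A valid lattice is a subgroup $L\subset\mathbb{Z}^2$ generated by two linearly independent vectors, each of which has both coordinates even or both coordinates odd. A tiling of $\mathbb{T}_L=\mathbb{R}^2/L$ is identified with an $L$-periodic tiling of $\mathbb{Z}^2$. Kasteleyn matrix: let $x_0$ be the smallest positive integer with $v_0=(x_0,0)\in L$, $y_1$ the smallest positive integer such that $L$ contains a vector with second coordinate $y_1$, and $v_1=(x_1,y_1)$ the unique such vector in $L$ with $0\le x_1<x_0$; $\{v_0,v_1\}$ generates $L$. The rectangle $D_L=[0,x_0]\times[0,y_1]$ is a fundamental domain with equally many black and white squares; enumerate its black squares $b_1,\dots,b_m$ and its white squares $w_1,\dots,w_m$ (arbitrarily). Let $G(\mathbb{Z}^2)$ be the graph whose vertices are the centers of unit squares, with edges joining centers of squares sharing a side (edges correspond to dominoes). An edge has sign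 $-1$ if it is horizontal with black left endpoint and white right endpoint, and $+1$ otherwise. Let $u(0)$ be the straight lattice path from $(0,0)$ to $v_0$ and $u(1)$ the lattice path $(0,0)\to(0,y_1)\to(x_1,y_1)$. Each $L$-orbit $[e]_L$ of edges of $G(\mathbb{Z}^2)$ has weight: its sign, multiplied for each $k\in\{0,1\}$ by $q_k$ (resp. $q_k^{-1}$) if some edge in $[e]_L$ crosses $u(k)$ with its black endpoint to the left (resp. right) of the oriented path $u(k)$, and by $1$ if no edge of $[e]_L$ crosses $u(k)$. The entry $K(i,j)$ is the sum of the weights of the $L$-orbits of edges joining an $L$-translate of $b_i$ to an $L$-translate of $w_j$ (0 if there are none). *)

(* Defs.v *)
From HB Require Import structures.
From mathcomp Require Import all_boot all_order all_algebra.
From mathcomp Require Import finmap.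
From mathcomp Require Import boolp classical_sets functions cardinality fsbigop.
From mathcomp.multinomials Require Import monalg.

Set Implicit Arguments.
Unset Strict Implicit.
Unset Printing Implicit Defensive.

Import Order.TTheory GRing.Theory Num.Theory.
Local Open Scope classical_set_scope.
Local Open Scope ring_scope.

(* The finitely supported functions int * int -> int; the pair (a, b) stands
   for the monomial q_0^a q_1^b.  {malg int[K]} is a ring only for monoids K
   without nontrivial units, so the convolution product over the group
   int * int is defined here; the additive structure is that of malg. *)
Definition laurent : Type := {malg int[(int * int)%type]}.

HB.instance Definition _ := GRing.Zmodule.on laurent.

Definition lmonom (a b : int) : laurent := << (a, b) >>.

Section LaurentRing.
Local Open Scope fset_scope.
Local Open Scope ring_scope.
Implicit Types f g h : laurent.

Definition lone : laurent := lmonom 0 0.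

Definition lmul f g : laurent :=
  \sum_(k <- msupp f) \sum_(l <- msupp g) << f@_k * g@_l *g k + l >>.

Lemma lmulw (d1 d2 : {fset int * int}) f g :
  msupp f `<=` d1 -> msupp g `<=` d2 ->
  lmul f g = \sum_(k <- d1) \sum_(l <- d2) << f@_k * g@_l *g k + l >>.
Proof.
move=> le_d1 le_d2; rewrite /lmul (big_fset_incl _ le_d1) /=.
  apply/eq_bigr=> k1 _; apply/big_fset_incl => // k _ /mcoeff_outdom ->.
  by rewrite mulr0 monalgU0.
move=> k _ /mcoeff_outdom fk.
by rewrite big1 => // k' _; rewrite fk mul0r monalgU0.
Qed.

Lemma lmulC : commutative lmul.
Proof.
move=> f g; rewrite /lmul exchange_big /=.
by apply/eq_bigr=> k _; apply/eq_bigr=> l _; rewrite mulrC addrC.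
Qed.

Lemma lmul0l : left_zero (0 : laurent) lmul.
Proof. by move=> g; rewrite /lmul msupp0 big_seq_fset0. Qed.

Lemma lmulDl : left_distributive lmul +%R.
Proof.
move=> f g h.
rewrite [in RHS](lmulw (fsubsetUl _ (msupp g)) (fsubset_refl _)).
rewrite [in RHS](lmulw (fsubsetUr (msupp f) _) (fsubset_refl _)).
rewrite (lmulw (msuppD_le _ _) (fsubset_refl _)).
rewrite -big_split /=; apply/eq_bigr=> k _.
rewrite -big_split /=; apply/eq_bigr=> l _.
by rewrite mcoeffD mulrDl monalgUD.
Qed.

Lemma lmulUU (c d : int) (k l : int * int) :
  lmul << c *g k >> << d *g l >> = << c * d *g k + l >>.
Proof. by rewrite (lmulw msuppU_le msuppU_le) !big_seq_fset1 !mcoeffUU. Qed.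

Lemma lmulDr : right_distributive lmul +%R.
Proof. by move=> f g h; rewrite !(lmulC f) lmulDl. Qed.

Lemma lmul0r : right_zero (0 : laurent) lmul.
Proof. by move=> f; rewrite lmulC lmul0l. Qed.

Lemma lmulA : associative lmul.
Proof.
move=> f g h; rewrite [f]monalgE; elim/big_ind: _ => [|f1 f2 IH1 IH2|k1 _].
- by rewrite !lmul0l.
- by rewrite !lmulDl IH1 IH2.
rewrite [g]monalgE; elim/big_ind: _ => [|g1 g2 IH1 IH2|k2 _].
- by rewrite lmul0l !lmul0r lmul0l.
- by rewrite lmulDl !lmulDr lmulDl IH1 IH2.
rewrite [h]monalgE; elim/big_ind: _ => [|h1 h2 IH1 IH2|k3 _].
- by rewrite !lmul0r.
- by rewrite !lmulDr IH1 IH2.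
by rewrite !lmulUU mulrA addrA.
Qed.

Lemma lmul1l : left_id lone lmul.
Proof.
move=> f; rewrite [f]monalgE; elim/big_ind: _ => [|f1 f2 IH1 IH2|k _].
- by rewrite lmul0r.
- by rewrite lmulDr IH1 IH2.
by rewrite lmulUU mul1r (add0r k : (0, 0) + k = k).
Qed.

Lemma lone_neq0 : lone != 0.
Proof. by rewrite monalgU_eq0 oner_eq0. Qed.

HB.instance Definition _ := GRing.Zmodule_isComNzRing.Build laurent
  lmulA lmulC lmul1l lmulDl lone_neq0.

End LaurentRing.

Definition leval (p : laurent) (q0 q1 : rat) : rat :=
  \sum_(k <- msupp p) (p@_k)%:~R * q0 ^ k.1 * q1 ^ k.2.

(* (i, j) stands for the unit square [i, i+1] x [j, j+1]. *)
Definition square : Type := (int * int)%type.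

Definition black (s : square) : bool := (2 %| s.1 + s.2)%Z.

Definition share_side (s t : square) : bool :=
  t - s \in [:: (1, 0); (-1, 0); (0, 1); (0, -1)].

(* A union of unit squares is given by the set of these squares; two such
   unions have disjoint interiors exactly when they have no common square. *)
Definition is_domino (D : set square) : Prop :=
  exists s t : square, share_side s t /\ D = [set s; t].

Definition is_tiling (T : set (set square)) : Prop :=
  [/\ T `<=` is_domino, trivIset T id & \bigcup_(D in T) D = setT].

Definition translate (v : int * int) (D : set square) : set square :=
  [set s + v | s in D].

Definition periodic (L : set (int * int)) (T : set (set square)) : Prop :=
  forall v D, L v -> T D -> T (translate v D).

Definition torus_tilings (L : set (int * int)) : set (set (set square)) :=
  [set T | is_tiling T /\ periodic L T].

Definition same_parity (v : int * int) : bool :=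
  (2 %| v.1)%Z == (2 %| v.2)%Z.

Definition lin_indep (u v : int * int) : Prop :=
  forall a b : int, u *~ a + v *~ b = 0 -> a = 0 /\ b = 0.

Definition valid_lattice (L : set (int * int)) : Prop :=
  exists u v : int * int,
    [/\ same_parity u, same_parity v, lin_indep u v &
        L = [set x | exists a b : int, x = u *~ a + v *~ b]].

(* v_0 = (x0, 0) and v_1 = (x1, y1). *)
Record lattice_basis (L : set (int * int)) (x0 x1 y1 : nat) : Prop :=
  LatticeBasis {
    x0_gt0 : (0 < x0)%N;
    x0_lattice : L (x0%:Z, 0);
    x0_min : forall x : nat, (0 < x)%N -> L (x%:Z, 0) -> (x0 <= x)%N;
    y1_gt0 : (0 < y1)%N;
    y1_min : forall (y : nat) (x : int),
      (0 < y)%N -> L (x, y%:Z) -> (y1 <= y)%N;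
    x1_lt : (x1 < x0)%N;
    v1_lattice : L (x1%:Z, y1%:Z)
  }.

(* The squares contained in [0, x0] x [0, y1]. *)
Definition rectangle (x0 y1 : nat) : set square :=
  [set s | 0 <= s.1 < x0%:Z /\ 0 <= s.2 < y1%:Z].

(* An edge of G(Z^2) is the pair (black endpoint, white endpoint), a unit square
   standing for its center. *)
Definition edge : Type := (square * square)%type.

Definition is_edge (e : edge) : bool :=
  [&& black e.1, ~~ black e.2 & share_side e.1 e.2].

Definition edge_orbit (L : set (int * int)) (e : edge) : set edge :=
  [set (e.1 + v, e.2 + v) | v in L].

(* The unit squares on the two sides of the oriented unit segment from p to q,
   p and q being neighbouring lattice points. *)
Definition left_square (p q : int * int) : square :=
  if q - p == (1, 0) then p
  else if q - p == (0, 1) then p - (1, 0)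
  else if q - p == (-1, 0) then q - (0, 1)
  else q.

Definition right_square (p q : int * int) : square := left_square q p.

(* A lattice path is the sequence of the lattice points it visits; an edge
   crosses it when the side shared by its two squares is a step of the path. *)
Definition path_u0 (x0 : nat) : seq (int * int) :=
  [seq (i%:Z, 0) | i <- iota 0 x0.+1].

Definition path_u1 (x1 y1 : nat) : seq (int * int) :=
  [seq (0, j%:Z) | j <- iota 0 y1.+1] ++ [seq (i%:Z, y1%:Z) | i <- iota 1 x1].

Definition steps (u : seq (int * int)) : seq ((int * int) * (int * int)) :=
  zip u (behead u).

Definition crosses_black_left (u : seq (int * int)) (e : edge) : bool :=
  has (fun s => e == (left_square s.1 s.2, right_square s.1 s.2)) (steps u).

Definition crosses_black_right (u : seq (int * int)) (e : edge) : bool :=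
  has (fun s => e == (right_square s.1 s.2, left_square s.1 s.2)) (steps u).

(* All edges of an orbit have the same sign. *)
Definition orbit_sign (o : set edge) : laurent :=
  if `[< exists2 e, o e & e.2 - e.1 = (1, 0) >] then -1 else 1.

(* The exponent of q_k, for u = u(k).  For the paths u(0) and u(1) at most one
   edge of an orbit crosses u, so that the two conditions exclude each other. *)
Definition orbit_crossing (u : seq (int * int)) (o : set edge) : int :=
  if `[< exists2 e, o e & crosses_black_left u e >] then 1
  else if `[< exists2 e, o e & crosses_black_right u e >] then -1
  else 0.

Definition orbit_weight (x0 x1 y1 : nat) (o : set edge) : laurent :=
  orbit_sign o *
  lmonom (orbit_crossing (path_u0 x0) o) (orbit_crossing (path_u1 x1 y1) o).

Definition joining_orbits (L : set (int * int)) (b w : square) :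
    set (set edge) :=
  [set o | exists e : edge, [/\ is_edge e, o = edge_orbit L e &
     exists v v', [/\ L v, L v' & e = (b + v, w + v')]]].

(* joining_orbits L b w has at most four elements, one for each neighbour
   of b. *)
Definition kasteleyn (L : set (int * int)) (x0 x1 y1 m : nat)
    (b w : 'I_m -> square) : 'M[laurent]_m :=
  \matrix_(i, j) \sum_(o \in joining_orbits L (b i) (w j))
    orbit_weight x0 x1 y1 o.

(* Main.v *)
Require Import Defs.
From mathcomp Require Import all_boot all_order all_fingroup all_algebra.
From mathcomp Require Import finmap.
From mathcomp Require Import boolp classical_sets functions cardinality fsbigop.
From mathcomp.multinomials Require Import monalg.
From mathcomp Require Import zify ring.

Set Implicit Arguments.
Unset Strict Implicit.
Unset Printing Implicit Defensive.

Import Order.TTheory GRing.Theory Num.Theory.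
Local Open Scope classical_set_scope.
Local Open Scope ring_scope.

(* Order the squares of the rectangle row by row and view each domino of a
   tiling of the torus as an arc between two positions, from its tail (its left
   or lower square) to its head.  Up to a constant, the sign of the permutation
   of a tiling is given by the number of crossing pairs of arcs and by the
   number of arcs whose black end comes first.  Arcs of horizontal dominoes can
   be ignored: such an arc joins neighbours in a row, or both ends of a row, and
   every row has evenly many ends of vertical arcs.  For the vertical arcs, the
   crossings are counted by the inversions of the map from tails to heads and by
   the ranks of the heads, and all dependence on the tiling reduces to its flux:
   if a and b are the numbers of dominoes crossing u(0) and u(1), then the
   monomial of the tiling in det K has sign (-1)^(c + C a + b + a b), with c and
   C independent of the tiling.  The Fourier transform on (Z/2)^2 of this
   function of (a, b) takes only the values 1/2 and -1/2.

   Parities are computed in bool, as the field with two elements. *)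

(** * Parity sums over pairs, inversions and crossings *)

(** Off-diagonal terms cancel in pairs in characteristic two; [enum_rank] serves to pick one term of
    each pair. *)
Lemma sum_symm_eq0 (T : finType) (h : T -> T -> bool) :
  (forall i j, h i j = h j i) -> (forall i, h i i = false) ->
  \sum_i \sum_j h i j = 0.
Proof.
move=> h_symm h_diag.
have -> : \sum_i \sum_j h i j =
    \sum_i \sum_j (enum_rank i < enum_rank j)%N * h i j +
    \sum_i \sum_j (enum_rank j < enum_rank i)%N * h i j.
  rewrite -big_split; apply: eq_bigr => i _; rewrite -big_split.
  apply: eq_bigr => j _ /=; rewrite -mulrDl.
  case: (ltngtP (enum_rank i) (enum_rank j)) => [||/val_inj/enum_rank_inj ->];
    by rewrite /= ?h_diag ?mul1r.
rewrite [X in X + _]exchange_big /=.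
under eq_bigr do under eq_bigr do rewrite h_symm.
exact: addbb.
Qed.

(** For a symmetric [g] only unordered pairs matter: the difference of the two sides is a symmetric
    sum with zero diagonal, since exchanging [i] and [j] flips both comparisons at once. *)
Lemma sum_pairs_order (T : finType) (V : pred T) (p q : T -> nat)
    (g : T -> T -> bool) :
  {in V &, injective p} -> {in V &, injective q} ->
  (forall i j, V i -> V j -> g i j = g j i) ->
  \sum_(i | V i) \sum_(j | V j) (p i < p j)%N * g i j =
  \sum_(i | V i) \sum_(j | V j) (q i < q j)%N * g i j.
Proof.
move=> p_inj q_inj g_symm; apply/eqP; rewrite -subr_eq0; apply/eqP.
rewrite -sumrB big_mkcond /=.
pose h i j : bool := V i * V j * ((p i < p j)%N + (q i < q j)%N) * g i j.
rewrite -[RHS](@sum_symm_eq0 _ h); last first.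
- by move=> i; rewrite /h !ltnn mulr0 mul0r.
- move=> i j; rewrite /h; case Vi: (V i); case Vj: (V j) => //=.
  rewrite g_symm //; have [->//|neq_ij] := eqVneq i j.
  have := contra_neq (p_inj i j Vi Vj) neq_ij.
  have := contra_neq (q_inj i j Vi Vj) neq_ij.
  by case: (ltngtP (q i)) => // _; case: (ltngtP (p i)).
apply: eq_bigr => i _; rewrite /h; case: (V i) => /=; last first.
  by rewrite big1 // => j _; rewrite !mul0r.
rewrite -sumrB big_mkcond /=; apply: eq_bigr => j _.
by case: (V j); case: (p i < p j)%N; case: (q i < q j)%N; case: (g i j).
Qed.

Lemma sum_upper m (g : 'I_m -> 'I_m -> bool) :
  \sum_i \sum_j g i j =
  \sum_(i < m) \sum_(j < m) (i < j)%N * (g i j + g j i) + \sum_i g i i.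
Proof.
have split_lt (i : 'I_m) : \sum_j g i j =
    \sum_(j < m) (i < j)%N * g i j + \sum_(j < m) (j < i)%N * g i j + g i i.
  rewrite (bigD1 i) //= [\sum_(j < m) _ * _](bigD1 i) //=.
  rewrite [X in _ + X + _](bigD1 i) //= ltnn !mul0r !add0r addrC.
  congr (_ + _); rewrite -big_split; apply: eq_bigr => j /= neq_ji.
  by move: neq_ji; rewrite -val_eqE /=; case: (ltngtP j i) => //; case: (g i j).
under eq_bigr do rewrite split_lt.
rewrite !big_split /= [X in _ + X + _]exchange_big -big_split /=.
congr (_ + _); apply: eq_bigr => i _; rewrite -big_split /=.
by apply: eq_bigr => j _; rewrite mulrDr.
Qed.

(* The parity of the number of crossings of the arcs a--b and c--d. *)
Definition cross (a b c d : nat) : bool :=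
  (c < a)%N (+) (d < b)%N (+) (d < a)%N (+) (c < b)%N.

Lemma prod_sign (R : pzRingType) (I : finType) (P : pred I) (f : I -> bool) :
  \prod_(i | P i) (-1) ^+ f i = (-1) ^+ (\sum_(i | P i) f i)%R :> R.
Proof. by elim/big_rec2: _ => // i x y _ ->; apply/esym/signr_addb. Qed.

(** The sign of a Vandermonde determinant is given by the inversions among its nodes, and permuting
    its columns by [s] multiplies it by the sign of [s]. *)
Lemma odd_perm_inversions m (Q : 'I_m -> nat) (s : {perm 'I_m}) :
  injective Q ->
  \sum_(i < m) \sum_(j < m) (i < j)%N * (Q (s j) < Q (s i))%N =
  odd_perm s + \sum_(i < m) \sum_(j < m) (i < j)%N * (Q j < Q i)%N.
Proof.
move=> Q_inj.
have vand (P : 'I_m -> nat) : injective P ->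
    Num.sg (\det (Vandermonde m (\row_i (P i)%:Z))) =
    (-1) ^+ (\sum_(i < m) \sum_(j < m) (i < j)%N * (P j < P i)%N)%R.
  move=> P_inj; rewrite det_Vandermonde (big_morph _ (@sgrM _) (@sgr1 _)).
  rewrite -prod_sign; apply: eq_bigr => i _.
  rewrite (big_morph _ (@sgrM _) (@sgr1 _)) -prod_sign big_mkcond /=.
  apply: eq_bigr => j _; case: ltnP => // lt_ij; rewrite !mxE mul1r.
  case: ltngtP => [lt_P|lt_P|/P_inj eq_ij]; last by rewrite eq_ij ltnn in lt_ij.
  - by rewrite expr1 ltr0_sg // subr_lt0.
  - by rewrite gtr0_sg // subr_gt0.
apply: (@signr_inj int); rewrite signr_addb -(vand _ Q_inj).
rewrite -(vand (Q \o s)); last by apply: inj_comp => //; apply: perm_inj.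
have -> : Vandermonde m (\row_i ((Q \o s) i)%:Z) =
    col_perm s (Vandermonde m (\row_i (Q i)%:Z)).
  by apply/matrixP => i j; rewrite !mxE.
rewrite col_permE det_mulmx det_perm odd_permV sgrM mulrC.
by congr (_ * _); case: (odd_perm s); rewrite ?expr1 ?sgrN1 ?sgr1.
Qed.

(** Two of the four comparisons in [cross] count inversions of [B] and of [W \o s]; the latter give
    the sign of [s] up to a constant. The two mixed ones, one of them negated at the cost of the
    number of pairs, add up to all comparisons of a [B] with a [W], a total independent of [s],
    minus the diagonal ones [B i < W (s i)]. *)
Lemma odd_perm_crossings m (B W : 'I_m -> nat) :
  injective B -> injective W -> (forall i j, B i != W j) ->
  exists c : bool, forall s : {perm 'I_m},
    odd_perm s = c + \sum_i (B i < W (s i))%N +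
      \sum_(i < m) \sum_(j < m)
         (i < j)%N * cross (B i) (W (s i)) (B j) (W (s j)).
Proof.
move=> B_inj W_inj BW.
exists (\sum_(i < m) \sum_(j < m) (i < j)%N * (W j < W i)%N +
  \sum_(i < m) \sum_(j < m) (i < j)%N * (B j < B i)%N +
  \sum_(i < m) \sum_(j < m) (i < j)%N + \sum_(i < m) \sum_(j < m) (B i < W
    j)%N).
move=> s.
have W_inv := odd_perm_inversions s W_inj.
have sum_BW : \sum_(i < m) \sum_(j < m) (B i < W j)%N =
    \sum_(i < m) \sum_(j < m)
      (i < j)%N * ((B i < W (s j))%N + (B j < W (s i))%N) +
    \sum_(i < m) (B i < W (s i))%N.
  have -> : \sum_(i < m) \sum_(j < m) (B i < W j)%N =
      \sum_(i < m) \sum_(j < m) (B i < W (s j))%N.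
    by apply: eq_bigr => i _; rewrite (reindex_inj (@perm_inj _ s)).
  exact: sum_upper.
have -> : \sum_(i < m) \sum_(j < m)
      (i < j)%N * cross (B i) (W (s i)) (B j) (W (s j)) =
    \sum_(i < m) \sum_(j < m) (i < j)%N * (W (s j) < W (s i))%N +
    \sum_(i < m) \sum_(j < m) (i < j)%N * (B j < B i)%N +
    \sum_(i < m) \sum_(j < m) (i < j)%N +
    \sum_(i < m) \sum_(j < m)
      (i < j)%N * ((B i < W (s j))%N + (B j < W (s i))%N).
  rewrite -!big_split; apply: eq_bigr => i _.
  rewrite -!big_split; apply: eq_bigr => j _; rewrite /cross /=.
  have := BW i (s j); rewrite neq_ltn.
  case: (ltngtP (B i) (W (s j))) => //= _ _; case: (i < j)%N; case: (_ < _)%N;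
    case: (_ < _)%N; case: (_ < _)%N => //.
rewrite W_inv sum_BW.
move: (\sum_(i < m) \sum_(j < m) _ * (W j < _)%N) => a1.
move: (\sum_(i < m) \sum_(j < m) _ * (B j < _)%N) => a2.
move: (\sum_(i < m) \sum_(j < m) (i < j)%N) => a3.
move: (\sum_(i < m) \sum_(j < m) _) => a4.
move: (\sum_(i < m) _) => a5.
by case: a1; case: a2; case: a3; case: a4; case: a5; case: (odd_perm s).
Qed.

Lemma addb_self (b : bool) : b + b = 0.
Proof. exact: addbb. Qed.

Lemma mulrn_bool (b : bool) n : b *+ n = b && odd n.
Proof. by elim: n => [|n IHn]; rewrite ?andbF // mulrS IHn /=; case: (odd n);
  case: {IHn} b. Qed.

Lemma sum_ltn_ord n h : (h <= n)%N -> \sum_(x < n) (x < h)%N = odd h.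
Proof.
move=> le_hn; transitivity (\sum_(x < h) true).
  by rewrite (big_ord_widen n (fun=> true)) // [RHS]big_mkcond;
    apply: eq_bigr => x _; case: ifP.
by rewrite sumr_const card_ord mulrn_bool.
Qed.

Lemma ltn_pos w x y x' y' : (x < w -> x' < w ->
  (y * w + x < y' * w + x') = (y < y') || (y == y') && (x < x'))%N.
Proof.
move=> lt_x lt_x'; case: (ltngtP y y') => [lt_y|lt_y|->] /=.
- by have := leq_mul lt_y (leqnn w); lia.
- by have := leq_mul lt_y (leqnn w); lia.
- by rewrite ltn_add2l.
Qed.

(** * Crossings of the arcs of a tiling in the fundamental rectangle *)

Section CrossingParity.

(** Arc [i] runs from its tail [(tx i, ty i)] to its head [(hx i, hy i)], and [V] marks the vertical
    arcs. The hypotheses describe a tiling of the torus; [cover] says, modulo two and against every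
    test function [F], that tails and heads together fill the rectangle. *)
Variables (m x0 x1 y1 : nat) (tx ty hx hy : 'I_m -> nat) (V : pred 'I_m).

Definition at_top i := ty i == y1.-1.
Definition at_right i := tx i == x0.-1.
(** This is the flux through u(0). The flux through u(1) is [wraps + topleft]: horizontal dominoes
    that wrap cross its vertical part, and vertical dominoes leaving the top row to the left of [x1]
    cross its horizontal part. *)
Definition flux0 := \sum_(i | V i) at_top i.
Definition wraps := \sum_(i | ~~ V i) at_right i.
Definition topleft := \sum_(i | V i) at_top i * (tx i < x1)%N.

Definition tpos i := (ty i * x0 + tx i)%N.
Definition hpos i := (hy i * x0 + hx i)%N.

Hypothesis x0_even : ~~ odd x0.
Hypothesis lt_x1 : (x1 < x0)%N.
Hypothesis odd_x1 : odd x1 = odd y1.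
Hypothesis lt_tx : forall i, (tx i < x0)%N.
Hypothesis lt_ty : forall i, (ty i < y1)%N.
Hypothesis headV : forall i, V i ->
  hx i = (if at_top i then if x1 <= tx i then tx i - x1 else tx i + x0 - x1
          else tx i)%N /\ hy i = (if at_top i then 0 else (ty i).+1)%N.
Hypothesis headH : forall i, ~~ V i ->
  hx i = (if at_right i then 0 else (tx i).+1)%N /\ hy i = ty i.
Hypothesis cover : forall F : nat -> nat -> bool,
  \sum_i (F (tx i) (ty i) + F (hx i) (hy i)) =
  \sum_(y < y1) \sum_(x < x0) F x y.
Hypothesis tail_inj : forall i j, tx i = tx j -> ty i = ty j -> i = j.
Hypothesis head_inj : forall i j, hx i = hx j -> hy i = hy j -> i = j.
Hypothesis tail_head : forall i j, tx i = hx j -> ty i <> hy j.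

Lemma lt_hx i : (hx i < x0)%N.
Proof.
have := lt_tx i; case: (boolP (V i)) => [/headV|/headH] [-> _].
  by case: ifP => _ //; case: ifP; lia.
by case: ifP; rewrite /at_right; lia.
Qed.

Lemma lt_hy i : (hy i < y1)%N.
Proof.
have := lt_ty i; case: (boolP (V i)) => [/headV|/headH] [_ ->] //.
by case: ifP; rewrite /at_top; lia.
Qed.

Lemma ltn_tt i j :
  (tpos i < tpos j)%N = (ty i < ty j)%N || (ty i == ty j) && (tx i < tx j)%N.
Proof. exact: ltn_pos. Qed.

Lemma ltn_th i j :
  (tpos i < hpos j)%N = (ty i < hy j)%N || (ty i == hy j) && (tx i < hx j)%N.
Proof. by apply: ltn_pos => //; apply: lt_hx. Qed.

Lemma ltn_ht i j :
  (hpos i < tpos j)%N = (hy i < ty j)%N || (hy i == ty j) && (hx i < tx j)%N.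
Proof. by apply: ltn_pos => //; apply: lt_hx. Qed.

Lemma ltn_hh i j :
  (hpos i < hpos j)%N = (hy i < hy j)%N || (hy i == hy j) && (hx i < hx j)%N.
Proof. by apply: ltn_pos => //; apply: lt_hx. Qed.

Lemma tpos_inj : injective tpos.
Proof.
move=> i j eq_p; apply: tail_inj; have := ltn_tt i j; have := ltn_tt j i;
  rewrite eq_p ltnn; lia.
Qed.

Lemma hpos_inj : injective hpos.
Proof.
move=> i j eq_p; apply: head_inj; have := ltn_hh i j; have := ltn_hh j i;
  rewrite eq_p ltnn; lia.
Qed.

Lemma tpos_hpos i j : tpos i != hpos j.
Proof.
apply/eqP => eq_p; have := @tail_head i j.
by have := ltn_th i j; have := ltn_ht j i; rewrite eq_p ltnn; lia.
Qed.

(** A row has the even number [x0] of squares, and a horizontal arc has both ends in one row. *)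
Lemma row_even y :
  \sum_(i | V i) (ty i == y) = \sum_(i | V i) (hy i == y).
Proof.
have := cover (fun _ y' => y' == y).
rewrite [RHS]big1 => [|y' _]; last by rewrite sumr_const card_ord mulrn_bool
  (negPf x0_even) andbF.
rewrite (bigID V) /= [X in _ + X]big1 => [|i /headH[_ ->]]; last exact: addbb.
by rewrite addr0 big_split /= => /eqP; rewrite addr_eq0 => /eqP ->.
Qed.

(** Induction on the row: its vertical heads come from the vertical tails of the row below, those of
    the bottom row from the top row, and [row_even] passes from heads to tails. *)
Lemma row_count y : (y < y1)%N -> \sum_(i | V i) (ty i == y) = flux0.
Proof.
elim: y => [|y IHy] lt_y; rewrite row_even.
  apply: eq_bigr => i /headV[_ ->]; case: (at_top i) => //.
rewrite -IHy 1?ltnW //; apply: eq_bigr => i /headV[_ ->]; rewrite /at_top.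
by case: ifP; lia.
Qed.

Lemma sum_rows (G : nat -> bool) :
  \sum_(i | V i) G (ty i) = (\sum_(y < y1) G y) * flux0.
Proof.
rewrite mulr_suml; transitivity
  (\sum_(i | V i) \sum_(y < y1) G y * (ty i == y)).
  apply: eq_bigr => i _; rewrite (bigD1 (Ordinal (lt_ty i))) //= eqxx.
  rewrite big1 ?addr0 ?mulr1 // => y; rewrite -val_eqE /= eq_sym.
  by move/negPf->; rewrite mulr0.
rewrite exchange_big; apply: eq_bigr => y _.
by rewrite -mulr_sumr row_count.
Qed.

(** A horizontal arc joins adjacent positions, with nothing between them, unless it wraps; then the
    rest of its row lies between its ends. *)
Lemma between_horizontal i x y : ~~ V i -> (x < x0)%N ->
  ~~ ((tx i == x) && (ty i == y)) -> ~~ ((hx i == x) && (hy i == y)) ->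
  (y * x0 + x < tpos i)%N (+) (y * x0 + x < hpos i)%N = at_right i && (y == ty
    i).
Proof.
move=> Vi lt_x; have := lt_hx i; have := lt_tx i.
have [hxE hyE] := headH Vi => lt_txi lt_hxi; rewrite !ltn_pos // hyE.
by move: lt_hxi; rewrite hxE /at_right; case: ifP; lia.
Qed.

(** Two arcs cross when exactly one end of [j] lies between the ends of [i]. *)
Lemma cross_horizontal i j : ~~ V i -> i != j ->
  cross (tpos i) (hpos i) (tpos j) (hpos j) =
  at_right i && ((ty j == ty i) (+) (hy j == ty i)).
Proof.
move=> Vi neq_ij; have b := between_horizontal Vi.
have t_ij : ~~ ((tx i == tx j) && (ty i == ty j)).
  by apply: contraNN neq_ij => /andP[/eqP ? /eqP ?]; apply/eqP/tail_inj.
have h_ij : ~~ ((hx i == hx j) && (hy i == hy j)).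
  by apply: contraNN neq_ij => /andP[/eqP ? /eqP ?]; apply/eqP/head_inj.
have th_ij : ~~ ((tx i == hx j) && (ty i == hy j)).
  by apply/negP => /andP[/eqP e /eqP]; apply: tail_head.
have ht_ij : ~~ ((hx i == tx j) && (hy i == ty j)).
  by apply/negP => /andP[/eqP e /eqP e']; apply: (tail_head (esym e)).
have := b _ _ (lt_tx j) t_ij ht_ij; have := b _ _ (lt_hx j) th_ij h_ij.
rewrite /cross -[(ty j * _ + _)%N]/(tpos j) -[(hy j * _ + _)%N]/(hpos j).
rewrite andb_addr => <- <-.
by do 4!case: (_ < _)%N.
Qed.

Lemma crossC i j : cross (tpos i) (hpos i) (tpos j) (hpos j) =
  cross (tpos j) (hpos j) (tpos i) (hpos i).
Proof.
rewrite /cross.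
have := tpos_hpos i j; have := tpos_hpos j i.
have [->|neq_ij] := eqVneq i j; first by rewrite !ltnn; case: ltngtP.
have := contra_neq (@tpos_inj i j) neq_ij.
have := contra_neq (@hpos_inj i j) neq_ij; lia.
Qed.

(** Two horizontal arcs never cross, since each stays in one row. The crossings of a wrapping
    horizontal arc with the vertical arcs have the parity of the number of vertical ends in its row,
    which is even. *)
Lemma cross_sum_verticals :
  \sum_(i < m) \sum_(j < m)
    (i < j)%N * cross (tpos i) (hpos i) (tpos j) (hpos j) =
  \sum_(i | V i) \sum_(j | V j)
    (i < j)%N * cross (tpos i) (hpos i) (tpos j) (hpos j).
Proof.
set c := fun i j => cross (tpos i) (hpos i) (tpos j) (hpos j).
have c_mixed : \sum_i \sum_j (~~ V i && V j && c i j) = 0.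
  rewrite (bigID V) /= big1 ?add0r => [|i Vi]; last first.
    by rewrite big1 // => j _; rewrite Vi.
  rewrite big1 // => i Vi; rewrite (bigID V) /= addrC big1 => [|j /negPf->];
    last by rewrite andbF.
  rewrite add0r (eq_bigr (fun j => at_right i * ((ty j == ty i) + (hy j == ty
    i)))).
    by rewrite -mulr_sumr big_split /= row_even addb_self mulr0.
  move=> j Vj; rewrite Vi Vj; apply: cross_horizontal => //.
  by apply: contraNneq Vi => ->.
(* The vanishing mixed sum runs over ordered pairs; folding it onto pairs [i < j] makes both sides
   agree term by term. *)
rewrite -[RHS]addr0 -[X in _ + X]c_mixed sum_upper.
rewrite [X in _ + (_ + X)]big1 => [|i _]; last by case: (V i).
rewrite addr0 [X in X + _]big_mkcond -big_split; apply: eq_bigr => i _ /=.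
rewrite -[X in X + _]/(if V i then _ else 0).
have -> : (if V i then \sum_(j | V j) (i < j)%N * c i j else 0) =
    \sum_j (V i && V j) * ((i < j)%N * c i j).
  case: (V i); last by rewrite big1.
  by rewrite big_mkcond; apply: eq_bigr => j _; case: (V j).
rewrite -big_split; apply: eq_bigr => j _ /=; rewrite [c j i]crossC -/(c i j).
have : ~~ V i -> ~~ V j -> (i < j)%N -> c i j = false.
  move=> Vi Vj lt_ij; rewrite /c cross_horizontal ?(headH Vj).2 ?addbb ?andbF
    //.
  by rewrite -val_eqE /= ltn_eqF.
rewrite -/(c i j); case: (V i); case: (V j); case: (i < j)%N;
  case: (c i j) => //.
by move/(_ isT isT isT).
Qed.

(** Moving up one row keeps the order. An inversion arises when only [j] goes from the top row to
    the bottom row, or when both do and the cyclic shift by [x1] carries the columns left of [x1]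
    behind the others. *)
Lemma inversions_verticals i j : V i -> V j ->
  (tpos i < tpos j)%N && (hpos j < hpos i)%N =
  at_top j && ~~ at_top i || at_top i && (tx i < x1)%N && (at_top j && (x1 <=
    tx j)%N).
Proof.
move=> Vi Vj; rewrite ltn_tt ltn_hh.
have := lt_tx i; have := lt_tx j; have := lt_ty i; have := lt_ty j.
have [-> ->] := headV Vi; have [-> ->] := headV Vj; rewrite /at_top.
by do !case: ifP; lia.
Qed.

(** The rank, modulo two, of the head of [i] among the ends of vertical arcs. *)
Definition vrank i := \sum_(j | V j) ((tpos j < hpos i)%N + (hpos j < hpos
  i)%N).

(** All squares before the head of [i] number [hx i] modulo two, as full rows are even. Horizontal
    arcs contribute both ends or none, except those wrapping in the row of the head. *)
Lemma vrank_parity i : V i ->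
  vrank i = odd (hx i) + \sum_(j | ~~ V j) at_right j * (ty j == hy i).
Proof.
move=> Vi; have := cover (fun x y => (y * x0 + x < hpos i)%N).
rewrite [RHS](bigD1 (Ordinal (lt_hy i))) //= [X in _ = _ + X]big1 => [|y];
  last first.
  rewrite -val_eqE /= => neq_y.
  rewrite (eq_bigr (fun _ => y < hy i)%N) => [|x _]; last first.
    by rewrite ltn_pos ?lt_hx // (negPf neq_y) orbF.
  by rewrite sumr_const card_ord mulrn_bool (negPf x0_even) andbF.
have -> : \sum_(x < x0) (hy i * x0 + x < hpos i)%N = odd (hx i).
  rewrite -(sum_ltn_ord (ltnW (lt_hx i))); apply: eq_bigr => x _.
  by rewrite ltn_pos ?lt_hx // eqxx ltnn.
rewrite addr0 => <-; rewrite (bigID V) /= -/(vrank i) -addrA -big_split.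
rewrite [X in _ + X]big1 ?addr0 // => j Vj /=.
have neq_ji : j != i by apply: contraNneq Vj => ->.
have t_ij : ~~ ((tx j == hx i) && (ty j == hy i)).
  by apply/negP => /andP[/eqP e /eqP]; apply: tail_head.
have h_ij : ~~ ((hx j == hx i) && (hy j == hy i)).
  by apply: contraNN neq_ji => /andP[/eqP ? /eqP ?]; apply/eqP/head_inj.
have := between_horizontal Vj (lt_hx i) t_ij h_ij; rewrite -/(hpos i) eq_sym.
have := tpos_hpos j i; have := contra_neq (@hpos_inj j i) neq_ji.
case: (ltngtP (hpos j)) => // _ _; case: (ltngtP (tpos j)) => // _ _ /=;
  by case: (at_right j); case: (ty j == hy i).
Qed.

(** Ordering the vertical arcs by their tails splits the crossings into inversions of the map from
    tails to heads and comparisons of heads with tails; the latter add up to the ranks of the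
    heads. *)
Lemma cross_sum :
  \sum_(i < m) \sum_(j < m)
    (i < j)%N * cross (tpos i) (hpos i) (tpos j) (hpos j) =
  \sum_(i | V i) ((tpos i < hpos i)%N + odd (hx i)) + wraps * flux0 +
  flux0 * (\sum_(y < y1) (y != y1.-1 :> nat)) + topleft * (flux0 + topleft).
Proof.
rewrite cross_sum_verticals.
rewrite (@sum_pairs_order _ V _ tpos);
  [|by move=> ? ? _ _; apply: val_inj|by move=> ? ? _ _; apply: tpos_inj|
   by move=> *; apply: crossC].
have -> : \sum_(i | V i) \sum_(j | V j) (tpos i < tpos j)%N *
      cross (tpos i) (hpos i) (tpos j) (hpos j) =
    \sum_(i | V i) ((tpos i < hpos i)%N + vrank i) +
    \sum_(i | V i) \sum_(j | V j) ((tpos i < tpos j)%N && (hpos j < hpos i)%N).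
  transitivity (\sum_(i | V i) \sum_(j | V j)
        (tpos i < tpos j)%N * (hpos j < tpos i)%N +
      \sum_(i | V i) \sum_(j | V j) (tpos i < tpos j)%N * (tpos j < hpos i)%N +
      \sum_(i | V i) \sum_(j | V j) (tpos i < tpos j)%N && (hpos j < hpos i)%N).
    rewrite -!big_split; apply: eq_bigr => i Vi.
    rewrite -!big_split; apply: eq_bigr => j Vj; rewrite /cross /=.
    by case: (ltngtP (tpos i)) => //= _; do 3!case: (_ < _)%N.
  congr (_ + _).
  (* Both sides count the unordered pairs of vertical arcs. *)
  have order : \sum_(i | V i) \sum_(j | V j) (hpos j < hpos i)%N =
      \sum_(i | V i) \sum_(j | V j) (tpos j < tpos i)%N.
    rewrite exchange_big [RHS]exchange_big /=.
    have times1 (p : 'I_m -> nat) :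
        \sum_(i | V i) \sum_(j | V j) (p i < p j)%N =
        \sum_(i | V i) \sum_(j | V j) (p i < p j)%N * 1.
      by apply: eq_bigr => i _; apply: eq_bigr => j _; rewrite mulr1.
    by rewrite (times1 hpos) (times1 tpos);
      apply: sum_pairs_order => // ? ? _ _;
      [apply: hpos_inj|apply: tpos_inj].
  have vrankE : \sum_(i | V i) vrank i =
      \sum_(i | V i) \sum_(j | V j) (tpos j < hpos i)%N +
      \sum_(i | V i) \sum_(j | V j) (tpos j < tpos i)%N.
    by rewrite -order -big_split; apply: eq_bigr => i _; rewrite -big_split.
  rewrite [in RHS]big_split /= vrankE.
  (* For fixed [i], the left side now counts the tails between the tail and the head of [i]; the
     term [tpos i < hpos i] makes up for [j = i]. *)
  rewrite [X in X + _ = _]exchange_big -!big_split; apply: eq_bigr => i Vi /=.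
  rewrite -!big_split /= (bigD1 i) //= [in RHS](bigD1 i) //= ltnn.
  set s1 := \sum_(_ < _ | _) _; set s2 := \sum_(_ < _ | _) _.
  have -> : s1 = s2.
    apply: eq_bigr => j /andP[Vj neq_ji].
    have := contra_neq (@tpos_inj j i) neq_ji; have := tpos_hpos j i.
    case: (ltngtP (tpos j) (tpos i)) => // _;
      by case: (ltngtP (tpos j) (hpos i)).
  by case: s2; case: (tpos i < hpos i)%N; case: (hpos i < tpos i)%N.
rewrite -!addrA !addrA -[RHS]addrA; congr (_ + _).
  rewrite (eq_bigr (fun i => ((tpos i < hpos i)%N + odd (hx i)) +
      \sum_(j | ~~ V j) at_right j * (ty j == hy i))); last first.
    by move=> i Vi; rewrite vrank_parity // addrA.
  rewrite big_split /=; congr (_ + _).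
  (* A wrapping horizontal arc is counted once for each vertical head in its row, so [flux0] times
     modulo two. *)
  rewrite exchange_big mulr_suml; apply: eq_bigr => j _ /=.
  rewrite -mulr_sumr; congr (_ * _).
  under eq_bigr do rewrite eq_sym.
  by rewrite -row_even row_count.
rewrite (eq_bigr (fun i => \sum_(j | V j) (~~ at_top i * at_top j +
    (at_top i * (tx i < x1)%N) * (at_top j * (x1 <= tx j)%N)))); last first.
  move=> i Vi; apply: eq_bigr => j Vj; rewrite inversions_verticals //.
  by case: (at_top i); case: (at_top j); case: (_ < _)%N; case: (_ <= _)%N.
under eq_bigr do rewrite big_split; rewrite big_split /=.
rewrite -!big_distrlr /= -/flux0 -/topleft; congr (_ + _ * _).
  (* Each row below the top one has [flux0] vertical tails modulo two, and [flux0] is idempotent. *)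
  rewrite (sum_rows (fun y => y != y1.-1)) mulrC.
  by case: flux0; case: (\sum_(y < y1) _).
rewrite -big_split; apply: eq_bigr => j _.
by rewrite leqNgt; case: (at_top j); case: (_ < _)%N.
Qed.

(** Sums over the rows the parity of [tx + ty + hx] for a vertical arc: it is that of [y] below the
    top row, and odd in the top row, where the shift by [x1] has the parity of [y1]. *)
Definition colour_const : bool :=
  \sum_(y < y1) (if y == y1.-1 :> nat then true else odd y).

Lemma colour_sum :
  \sum_(i | V i) (odd (tx i + ty i) + odd (hx i)) = colour_const * flux0.
Proof.
rewrite -(sum_rows (fun y => if y == y1.-1 then true else odd y)).
apply: eq_bigr => i Vi; have [-> _] := headV Vi; rewrite -/(at_top i).
have := lt_tx i; have := lt_ty i; have := odd_x1; have := x0_even.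
change (GRing.add (odd (tx i + ty i))) with (addb (odd (tx i + ty i))).
rewrite /at_top; case: eqP => [->|_]; last by lia.
by case: ifP; lia.
Qed.

(** [P] and [Q] are the positions of the black and white ends, and [neg] says that the tail is
    white. The Kasteleyn signs of horizontal dominoes cancel their colour order up to [wraps]; for
    vertical ones the colour order combines with the terms [tpos < hpos] and [odd (hx i)] of
    [cross_sum] into [colour_sum]. *)
Lemma kasteleyn_parity (P Q : 'I_m -> nat) (neg : 'I_m -> bool) :
  (forall i, (tpos i, hpos i) = if neg i then (Q i, P i) else (P i, Q i)) ->
  (forall i, V i -> neg i = odd (tx i + ty i)) ->
  \sum_i (P i < Q i)%N +
    \sum_(i < m) \sum_(j < m) (i < j)%N * cross (P i) (Q i) (P j) (Q j) +
    \sum_i (~~ V i && ~~ neg i) =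
  (colour_const + \sum_(y < y1) (y != y1.-1 :> nat)) * flux0 +
  (wraps + topleft) + flux0 * (wraps + topleft).
Proof.
move=> PQ negV; have PQi i := PQ i.
rewrite (_ : \sum_(i < m) _ = \sum_(i < m) \sum_(j < m)
    (i < j)%N * cross (tpos i) (hpos i) (tpos j) (hpos j)); last first.
  apply: eq_bigr => i _; apply: eq_bigr => j _; congr (_ * _); rewrite /cross.
  move: (PQ i) (PQ j).
  by case: (neg i) => -[-> ->]; case: (neg j) => -[-> ->];
    do 4!case: (_ < _)%N.
have -> : \sum_i (~~ V i && ~~ neg i) =
    \sum_i (P i < Q i)%N + \sum_(i | V i) (P i < Q i)%N + wraps.
  rewrite (bigID V) [in RHS](bigID V) /= big1 ?add0r => [|i -> //].
  rewrite [X in _ = X + _]addrAC addb_self add0r -big_split.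
  apply: eq_bigr => i Vi /=.
  (* A horizontal arc goes backwards exactly when it wraps. *)
  have : (tpos i < hpos i)%N = ~~ at_right i.
    rewrite ltn_th; have := lt_tx i; have [-> ->] := headH Vi.
    by rewrite /at_right; case: ifP; lia.
  have := tpos_hpos i i; have := PQ i; rewrite Vi.
  by case: (neg i) => -[-> ->]; case: ltngtP; case: (at_right i).
rewrite cross_sum big_split /=.
have := colour_sum; rewrite big_split /=.
have -> : \sum_(i | V i) odd (tx i + ty i) =
    \sum_(i | V i) (P i < Q i)%N + \sum_(i | V i) (tpos i < hpos i)%N.
  rewrite -big_split; apply: eq_bigr => i Vi /=; rewrite -negV //.
  have := tpos_hpos i i; have := PQ i.
  by case: (neg i) => -[-> ->]; case: ltngtP.
move: (\sum_(i | V i) odd _) => a1.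
move: (\sum_(i | V i) (P i < Q i)%N) (\sum_i (P i < Q i)%N) => a2 a3.
move: (\sum_(i | V i) (tpos i < _)%N) (\sum_(y < y1) _) => a4 a5 E.
have -> : a4 + a1 = colour_const * flux0 + a2.
  by rewrite -E; case: {E} a4; case: a2; case: a1.
move: wraps flux0 topleft colour_const {E} => a6 a7 a8 a9.
by case: a2; case: a3; case: a5; case: a6; case: a7; case: a8; case: a9.
Qed.

End CrossingParity.

(** * Reduction modulo a valid lattice to the fundamental rectangle *)

Lemma addr_pair (a b c d : int) : ((a, b) : int * int) + (c, d) = (a + c, b +
  d).
Proof. by []. Qed.

Lemma subr_pair (a b c d : int) : ((a, b) : int * int) - (c, d) = (a - c, b -
  d).
Proof. by []. Qed.

Lemma mulrz_pair (u : int * int) (k : int) : u *~ k = (u.1 * k, u.2 * k).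
Proof.
have mulrn_pair n : u *+ n = (u.1 * n%:Z, u.2 * n%:Z).
  elim: n => [|n IHn]; first by rewrite mulr0n !mulr0.
  by rewrite mulrS IHn -addn1 PoszD !mulrDr !mulr1 ![_ * n%:Z + _]addrC.
case: k => n; first exact: mulrn_pair.
rewrite NegzE mulrNz [u *~ _](mulrn_pair n.+1).
by apply/pair_equal_spec; split; rewrite /= mulrN.
Qed.

Section ValidLattice.

Variable L : set (int * int).
Hypothesis validL : valid_lattice L.

Lemma lattice0 : L 0.
Proof.
by case: validL => u [v [_ _ _ ->]]; exists 0, 0; rewrite !mulr0z addr0.
Qed.

Lemma latticeD u v : L u -> L v -> L (u + v).
Proof.
case: validL => e [f [_ _ _ ->]] [a [c ->]] [a' [c' ->]].
by exists (a + a'), (c + c'); rewrite !mulrzDr addrACA.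
Qed.

Lemma latticeN u : L u -> L (- u).
Proof.
case: validL => e [f [_ _ _ ->]] [a [c ->]].
by exists (- a), (- c); rewrite !mulrNz opprD.
Qed.

Lemma latticeB u v : L u -> L v -> L (u - v).
Proof. by move=> Lu Lv; apply: latticeD => //; apply: latticeN. Qed.

Lemma latticeMz u a : L u -> L (u *~ a).
Proof.
move=> Lu; have LMn n : L (u *+ n).
  by elim: n => [|n IHn]; rewrite ?mulr0n ?mulrS;
    [apply: lattice0|apply: latticeD].
by case: a => n; [|apply: latticeN]; apply: LMn.
Qed.

Lemma lattice_parity v : L v -> (2 %| v.1 + v.2)%Z.
Proof.
case: validL => e [f [e2 f2 _ ->]] [a [c ->]].
rewrite !mulrz_pair /= addrACA -!mulrDl rpredD // dvdz_mulr //.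
  by move: e2; rewrite /same_parity; lia.
by move: f2; rewrite /same_parity; lia.
Qed.

Lemma black_lattice s v : L v -> black (s + v) = black s.
Proof.
move=> /lattice_parity; case: s v => s1 s2 [v1 v2]; rewrite /black /=; lia.
Qed.

Variables x0 x1 y1 : nat.
Hypothesis basisL : lattice_basis L x0 x1 y1.

Let x0_gt0 := x0_gt0 basisL.
Let y1_gt0 := y1_gt0 basisL.

Lemma x0_even : ~~ odd x0.
Proof. by have /= := lattice_parity (x0_lattice basisL); lia. Qed.

Lemma odd_x1_y1 : odd x1 = odd y1.
Proof. by have /= := lattice_parity (v1_lattice basisL); lia. Qed.

(** Minimality of [y1] forces equal rows, and then minimality of [x0] forces equal columns. *)
Lemma rectangle_unique s t :
  rectangle x0 y1 s -> rectangle x0 y1 t -> L (s - t) -> s = t.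
Proof.
wlog le_ts : s t / t.2 <= s.2 => [hwlog|].
  have [|lt_st] := leP t.2 s.2; first exact: hwlog.
  move=> s_rect t_rect /latticeN; rewrite opprB => Lts.
  by apply/esym/hwlog => //; apply: ltW.
case: s t le_ts => [a c] [a' c'] /= le_c [/= a_lt c_lt] [/= a'_lt c'_lt] Lst.
have eq_c : c = c'.
  have [//|neq_c] := eqVneq c c'.
  have /= := @y1_min _ _ _ _ basisL `|c - c'|%N (a - a').
  rewrite gez0_abs ?subr_ge0 // => /(_ _ Lst); lia.
move: Lst; rewrite {}eq_c in le_c c_lt * => Lst.
have [->//|neq_a] := eqVneq a a'.
have L0 : L (a - a', 0) by move: Lst; rewrite subr_pair subrr.
have := @x0_min _ _ _ _ basisL `|a - a'|%N.
have [le_a|lt_a] := leP a' a.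
  by rewrite gez0_abs ?subr_ge0 // => /(_ _ L0); lia.
have LN : L (a' - a, 0) by move: (latticeN Lst); rewrite opprB subr_pair subrr.
by rewrite distnC gez0_abs ?subr_ge0 ?ltW // => /(_ _ LN); lia.
Qed.

Lemma rectangle_exists s :
  exists2 t, rectangle x0 y1 t & L (s - t).
Proof.
(* First a multiple of v_1 brings the row into range, then a multiple of v_0 the column. *)
case: s => a c; set k := (c %/ y1%:Z)%Z.
set l := ((a - x1%:Z * k) %/ x0%:Z)%Z.
exists (a - x1%:Z * k - x0%:Z * l, c - y1%:Z * k); last first.
  have -> : ((a, c) : int * int) - (a - x1%:Z * k - x0%:Z * l, c - y1%:Z * k) =
      (x1%:Z, y1%:Z) *~ k + (x0%:Z, 0) *~ l.
    rewrite !mulrz_pair /=; set k0 := x0%:Z; set k1 := x1%:Z; set k2 := y1%:Z.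
    by apply/pair_equal_spec; split=> /=; ring.
  apply: latticeD; apply: latticeMz; [exact: (v1_lattice basisL)|].
  exact: (x0_lattice basisL).
have y1_pos : 0 < y1%:Z by lia.
have x0_pos : 0 < x0%:Z by lia.
have := modz_ge0 c (lt0r_neq0 y1_pos); have := ltz_pmod c y1_pos.
have := modz_ge0 (a - x1%:Z * k) (lt0r_neq0 x0_pos).
have := ltz_pmod (a - x1%:Z * k) x0_pos.
rewrite /modz -/k -/l /rectangle /= ![_ * x0%:Z]mulrC ![_ * y1%:Z]mulrC => *.
by split; apply/andP.
Qed.

(** Above the top row one subtracts v_1, and adds v_0 if the column became negative. *)
Lemma vertical_head s t : rectangle x0 y1 s -> rectangle x0 y1 t ->
  L (s + (0, 1) - t) ->
  t = (if s.2 == y1%:Z - 1 then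
         if x1%:Z <= s.1 then s.1 - x1%:Z else s.1 + x0%:Z - x1%:Z
       else s.1, if s.2 == y1%:Z - 1 then 0 else s.2 + 1).
Proof.
move=> s_rect t_rect Lst; apply: rectangle_unique => //.
  case: s s_rect {Lst} => a c [/= a_lt c_lt]; have := x1_lt basisL.
  by split => /=; case: ifP; try case: ifP; lia.
have [u Lu ->] : exists2 u, L u & t = s + (0, 1) - u.
  by exists (s + (0, 1) - t) => //; rewrite opprB addrC subrK.
set r := (X in L (_ - X)); rewrite addrAC; apply: latticeB => //.
rewrite /r {r}; case: s {s_rect t_rect Lst} => a c /=.
case: eqP => [->|_]; last first.
  by rewrite addr_pair subr_pair addr0 !subrr; apply: lattice0.
case: ifP => _.
  rewrite addr_pair subr_pair (_ : (_, _) = (x1%:Z, y1%:Z));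
    first exact: (v1_lattice basisL).
  by congr (_, _); ring.
rewrite addr_pair subr_pair (_ : (_, _) = ((x1%:Z, y1%:Z) : int * int) -
  (x0%:Z, 0)).
  by apply: latticeB; [exact: (v1_lattice basisL)|exact: (x0_lattice basisL)].
by rewrite subr_pair; congr (_, _); ring.
Qed.

Lemma horizontal_head s t : rectangle x0 y1 s -> rectangle x0 y1 t ->
  L (s + (1, 0) - t) ->
  t = (if s.1 == x0%:Z - 1 then 0 else s.1 + 1, s.2).
Proof.
move=> s_rect t_rect Lst; apply: rectangle_unique => //.
  case: s s_rect {Lst} => a c [/= a_lt c_lt].
  by split => //=; case: ifP; lia.
have [u Lu ->] : exists2 u, L u & t = s + (1, 0) - u.
  by exists (s + (1, 0) - t) => //; rewrite opprB addrC subrK.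
set r := (X in L (_ - X)); rewrite addrAC; apply: latticeB => //.
rewrite /r {r}; case: s {s_rect t_rect Lst} => a c /=.
case: eqP => [->|_]; last first.
  by rewrite addr_pair subr_pair addr0 !subrr; apply: lattice0.
rewrite addr_pair subr_pair (_ : (_, _) = (x0%:Z, 0));
  first exact: (x0_lattice basisL).
by congr (_, _); ring.
Qed.

End ValidLattice.

(** * Directions of edges and crossings with the two paths *)

Definition unit_vec (vert : bool) : int * int :=
  if vert then (0, 1) else (1, 0).

(* (vert, neg) stands for the step by the vertical or horizontal unit vector,
   negated if neg. *)
Definition direction : Type := (bool * bool)%type.

Definition dvec (d : direction) : int * int :=
  if d.2 then - unit_vec d.1 else unit_vec d.1.

Lemma dvec_inj : injective dvec.
Proof. by case=> -[] [] [[] []]. Qed.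

Lemma share_sideP s t :
  reflect (exists d : direction, t = s + dvec d) (share_side s t).
Proof.
apply: (iffP idP) => [|[d ->]]; last first.
  by rewrite /share_side addrAC subrr add0r; case: d => -[] [].
rewrite /share_side !inE => /or4P[] /eqP e.
- by exists (false, false); rewrite -[LHS](subrK s) e addrC.
- by exists (false, true); rewrite -[LHS](subrK s) e addrC.
- by exists (true, false); rewrite -[LHS](subrK s) e addrC.
- by exists (true, true); rewrite -[LHS](subrK s) e addrC.
Qed.

Lemma black_dvec s (d : direction) : black (s + dvec d) = ~~ black s.
Proof.
by rewrite /black; case: s d => a c [[] []];
  rewrite /dvec /unit_vec ?addr_pair /=; lia.
Qed.

Lemma steps_map (g : nat -> int * int) k n :
  steps [seq g i | i <- iota k n.+1] = [seq (g i, g i.+1) | i <- iota k n].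
Proof. by elim: n k => // n IHn k; rewrite /steps /= -/(steps _) -IHn. Qed.

Lemma steps_u0 x0 : steps (path_u0 x0) =
  [seq ((i%:Z, 0), (i.+1%:Z, 0)) | i <- iota 0 x0].
Proof. exact: steps_map (fun i => (i%:Z, 0)) _ _. Qed.

Lemma steps_u1 x1 y1 : steps (path_u1 x1 y1) =
  [seq ((0, j%:Z), (0, j.+1%:Z)) | j <- iota 0 y1] ++
  [seq ((i%:Z, y1%:Z), (i.+1%:Z, y1%:Z)) | i <- iota 0 x1].
Proof.
(* A single parametrization of both legs, with the corner at [i = y1], so that [steps_map] also
   covers the turn. *)
pose g i : int * int := if (i < y1)%N then (0, i%:Z) else ((i - y1)%:Z, y1%:Z).
have -> : path_u1 x1 y1 = [seq g i | i <- iota 0 (y1 + x1).+1].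
  rewrite -addSn iotaD map_cat; congr (_ ++ _).
    apply/eq_in_map => i; rewrite mem_iota /g add0n ltnS => /andP[_].
    by rewrite leq_eqVlt; case: ltngtP => // -> _; rewrite subnn.
  rewrite add0n -[y1.+1]addn1 iotaDl -map_comp; apply/eq_in_map => i.
  by rewrite mem_iota /g /= => /andP[i_gt0 _]; rewrite ltnNge leq_addr addKn.
rewrite steps_map iotaD map_cat; congr (_ ++ _).
  apply/eq_in_map => i; rewrite mem_iota /g add0n => /andP[_ lt_i].
  rewrite lt_i; case: (ltngtP i.+1 y1) => // [|->]; [lia|by rewrite subnn].
rewrite add0n -[y1 in iota y1]addn0 iotaDl -map_comp; apply/eq_in_map => i _.
rewrite /= /g.
have -> : (y1 + i < y1)%N = false by lia.
have -> : ((y1 + i).+1 < y1)%N = false by lia.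
by rewrite -addnS !addKn.
Qed.

(** The side of the black end is forgotten: at arguments 1 and -1 only the parity of an exponent
    matters. *)
Definition crosses u e := crosses_black_left u e || crosses_black_right u e.

Lemma Posz_succ n : n.+1%:Z = n%:Z + 1.
Proof. by rewrite -addn1 PoszD. Qed.

Definition low_square (s : square) (d : direction) := if d.2 then s + dvec d
  else s.

Definition high_square (s : square) (d : direction) := if d.2 then s else s +
  dvec d.

Lemma high_low_square s d : high_square s d = low_square s d + unit_vec d.1.
Proof. by rewrite /high_square /low_square /dvec; case: d.2;
  rewrite ?subrK. Qed.

(** The upper square on a step to the right has the starting point [p] of the step as its lower left
    corner. *)
Lemma cross_right_step (s : square) (d : direction) (i j : int)
    (p := (i, j)) (q := (i + 1, j)) :
  ((s, s + dvec d) == (left_square p q, right_square p q)) ||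
  ((s, s + dvec d) == (right_square p q, left_square p q)) =
  d.1 && (high_square s d == p).
Proof.
rewrite /p /q /right_square /left_square !subr_pair.
have -> : (i + 1 - i, j - j) = (1, 0) :> square by congr (_, _); lia.
have -> : (i - (i + 1), j - j) = (-1, 0) :> square by congr (_, _); lia.
rewrite /= !xpair_eqE /high_square /dvec /unit_vec; case: s => a c.
by case: d => -[] [] /=; rewrite !xpair_eqE /=; lia.
Qed.

Lemma cross_up_step (s : square) (d : direction) (i j : int)
    (p := (i, j)) (q := (i, j + 1)) :
  ((s, s + dvec d) == (left_square p q, right_square p q)) ||
  ((s, s + dvec d) == (right_square p q, left_square p q)) =
  ~~ d.1 && (high_square s d == p).
Proof.
rewrite /p /q /right_square /left_square !subr_pair.
have -> : (i - i, j + 1 - j) = (0, 1) :> square by congr (_, _); lia.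
have -> : (i - i, j - (j + 1)) = (0, -1) :> square by congr (_, _); lia.
rewrite /= !xpair_eqE /high_square /dvec /unit_vec; case: s => a c.
by case: d => -[] [] /=; rewrite !xpair_eqE /=; lia.
Qed.

Lemma crosses_u0 x0 (s : square) (d : direction) :
  crosses (path_u0 x0) (s, s + dvec d) =
  [&& d.1, (high_square s d).2 == 0 & 0 <= (high_square s d).1 < x0%:Z].
Proof.
rewrite /crosses /crosses_black_left /crosses_black_right steps_u0 !has_map.
rewrite -has_predU; apply/hasP/idP => /= [[i]|].
  rewrite mem_iota => lt_i; rewrite /= Posz_succ cross_right_step.
  by case/andP=> -> /eqP ->; rewrite /=; lia.
case/and3P => d1 /eqP h2 h1; exists `|(high_square s d).1|%N.
  by rewrite mem_iota; lia.
rewrite /= Posz_succ cross_right_step d1 /= gez0_abs; last by lia.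
by rewrite -h2 -surjective_pairing.
Qed.

Lemma crosses_u1 x1 y1 (s : square) (d : direction) :
  crosses (path_u1 x1 y1) (s, s + dvec d) =
  if d.1 then ((high_square s d).2 == y1%:Z) && (0 <= (high_square s d).1 <
    x1%:Z)
  else ((high_square s d).1 == 0) && (0 <= (high_square s d).2 < y1%:Z).
Proof.
rewrite /crosses /crosses_black_left /crosses_black_right steps_u1.
rewrite -has_predU has_cat !has_map /=; apply/orP/idP => /= [[] /hasP[i]|].
- rewrite mem_iota => lt_i; rewrite /= Posz_succ cross_up_step.
  by case/andP=> /negPf-> /eqP ->; rewrite /=; lia.
- rewrite mem_iota => lt_i; rewrite /= Posz_succ cross_right_step.
  by case/andP=> -> /eqP ->; rewrite /=; lia.
case: ifP => d1 /andP[/eqP h2 h1]; [right|left]; apply/hasP.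
  exists `|(high_square s d).1|%N; first by rewrite mem_iota; lia.
  rewrite /= Posz_succ cross_right_step d1 /= gez0_abs; last by lia.
  by rewrite -h2 -surjective_pairing.
exists `|(high_square s d).2|%N; first by rewrite mem_iota; lia.
rewrite /= Posz_succ cross_up_step d1 /= gez0_abs; last by lia.
by rewrite -h2 -surjective_pairing.
Qed.

(** * Evaluation of Laurent polynomials and of orbit weights *)

Section Evaluation.

Variables q0 q1 : rat.
Hypotheses (q0_neq0 : q0 != 0) (q1_neq0 : q1 != 0).

Local Notation eval p := (leval p q0 q1).

Lemma leval_supp (d : {fset int * int}) (f : laurent) : (msupp f `<=` d)%fset ->
  eval f = \sum_(k <- d) (f@_k)%:~R * q0 ^ k.1 * q1 ^ k.2.
Proof.
move=> le_d; apply: big_fset_incl => // k _ /mcoeff_outdom ->.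
by rewrite mulr0z !mul0r.
Qed.

Lemma leval0 : eval 0 = 0.
Proof. by rewrite /leval msupp0 big_seq_fset0. Qed.

Lemma levalD f g : eval (f + g) = eval f + eval g.
Proof.
rewrite (leval_supp (msuppD_le _ _)) (leval_supp (fsubsetUl _ (msupp g))).
rewrite [eval g](leval_supp (fsubsetUr (msupp f) _)) -big_split /=.
by apply: eq_bigr => k _; rewrite mcoeffD rmorphD !mulrDl.
Qed.

Lemma levalU (c : int) (k : int * int) :
  eval << c *g k >> = c%:~R * q0 ^ k.1 * q1 ^ k.2.
Proof. by rewrite (leval_supp msuppU_le) big_seq_fset1 mcoeffUU. Qed.

Lemma levalM f g : eval (f * g) = eval f * eval g.
Proof.
change (f * g) with (lmul f g).
rewrite [f]monalgE; elim/big_ind: _ => [|f1 f2 IH1 IH2|k1 _].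
- by rewrite lmul0l leval0 mul0r.
- by rewrite lmulDl levalD (levalD f1 f2) mulrDl; apply: congr2 IH1 IH2.
rewrite [g]monalgE; elim/big_ind: _ => [|g1 g2 IH1 IH2|k2 _].
- by rewrite lmul0r leval0 mulr0.
- by rewrite lmulDr levalD (levalD g1 g2) mulrDr; apply: congr2 IH1 IH2.
by rewrite lmulUU !levalU rmorphM /= !expfzDr //; ring.
Qed.

Lemma leval1 : eval 1 = 1.
Proof. by rewrite [1]/(lmonom 0 0) levalU !expr0z !mulr1. Qed.

Lemma levalN f : eval (- f) = - eval f.
Proof. by apply/eqP; rewrite -addr_eq0 -levalD addNr leval0. Qed.

Lemma leval_det n (A : 'M[laurent]_n) :
  eval (\det A) =
  \sum_(s : 'S_n) (-1) ^+ odd_perm s * \prod_i eval (A i (s i)).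
Proof.
rewrite /determinant (big_morph _ levalD leval0); apply: eq_bigr => s _.
rewrite levalM (big_morph _ levalM leval1).
by congr (_ * _); case: odd_perm; rewrite ?levalN leval1.
Qed.

End Evaluation.

Lemma signr_exprz (R : unitRingType) (a : bool) (n : int) :
  ((-1) ^+ a : R) ^ n = (-1) ^+ (a && odd `|n|%N).
Proof.
case: a => /=; last by rewrite exp1rz.
rewrite expr1 signr_odd; case: n => n //.
by apply: etrans (esym (exprVn (-1 : R) n.+1)) _; rewrite invrN1.
Qed.

Lemma odd_orbit_crossing u o :
  odd `|orbit_crossing u o|%N = `[< exists2 e, o e & crosses u e >].
Proof.
rewrite /orbit_crossing.
case: asboolP => [[e oe ce]|no_left].
  by apply/esym/asboolP; exists e; rewrite ///crosses ce.
case: asboolP => [[e oe ce]|no_right].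
  by apply/esym/asboolP; exists e; rewrite ///crosses ce orbT.
apply/esym/negbTE/asboolPn => -[e oe /orP[ce|ce]];
  [apply: no_left|apply: no_right];
  by exists e.
Qed.

Lemma leval_orbit_weight x0 x1 y1 o (p q : bool) :
  leval (orbit_weight x0 x1 y1 o) ((-1) ^+ p) ((-1) ^+ q) =
  (-1) ^+ (`[< exists2 e, o e & e.2 - e.1 = (1, 0) >] +
    p * `[< exists2 e, o e & crosses (path_u0 x0) e >] +
    q * `[< exists2 e, o e & crosses (path_u1 x1 y1) e >])%R.
Proof.
rewrite /orbit_weight levalM ?signr_eq0 // /lmonom levalU mul1r !signr_exprz.
rewrite !odd_orbit_crossing [RHS]signr_addb signr_addb -mulrA; congr (_ * _).
rewrite /orbit_sign; case: asbool; last by rewrite leval1.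
by rewrite levalN leval1.
Qed.

(** * Entries of the Kasteleyn matrix and the expansion of its determinant *)

Section KasteleynEntries.

Variables (L : set (int * int)) (x0 x1 y1 m : nat) (b w : 'I_m -> square).
Hypothesis validL : valid_lattice L.
Hypothesis basisL : lattice_basis L x0 x1 y1.
Hypothesis b_bij : set_bij [set: 'I_m] [set s | rectangle x0 y1 s /\ black s] b.
Hypothesis w_bij : set_bij [set: 'I_m] [set s | rectangle x0 y1 s /\ ~~ black
  s] w.

Lemma b_rect i : rectangle x0 y1 (b i).
Proof. by have [] := set_bij_sub b_bij (imageT b i). Qed.

Lemma b_black i : black (b i).
Proof. by have [] := set_bij_sub b_bij (imageT b i). Qed.

Lemma w_rect i : rectangle x0 y1 (w i).
Proof. by have [] := set_bij_sub w_bij (imageT w i). Qed.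

Lemma w_white i : ~~ black (w i).
Proof. by have [] := set_bij_sub w_bij (imageT w i). Qed.

Lemma b_inj : injective b.
Proof. by move=> i j; apply: (set_bij_inj b_bij); rewrite inE. Qed.

Lemma w_inj : injective w.
Proof. by move=> i j; apply: (set_bij_inj w_bij); rewrite inE. Qed.

Lemma b_lattice_inj i j : L (b i - b j) -> i = j.
Proof.
move=> Lij; apply: b_inj.
by apply: (rectangle_unique validL basisL) Lij; apply: b_rect.
Qed.

Lemma w_lattice_inj i j : L (w i - w j) -> i = j.
Proof.
move=> Lij; apply: w_inj.
by apply: (rectangle_unique validL basisL) Lij; apply: w_rect.
Qed.

Lemma black_rep s : black s -> exists i, L (s - b i).
Proof.
move=> s_black; have [t t_rect Lst] := rectangle_exists validL basisL s.
have t_black : black t.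
  by rewrite -(black_lattice validL _ Lst) addrC subrK.
by have [i _ ti] := set_bij_surj b_bij (conj t_rect t_black); exists i;
  rewrite ti.
Qed.

Lemma white_rep s : ~~ black s -> exists j, L (s - w j).
Proof.
move=> s_white; have [t t_rect Lst] := rectangle_exists validL basisL s.
have t_white : ~~ black t.
  by rewrite -(black_lattice validL _ Lst) addrC subrK.
by have [i _ ti] := set_bij_surj w_bij (conj t_rect t_white); exists i;
  rewrite ti.
Qed.

Lemma nb_white i d : ~~ black (b i + dvec d).
Proof. by rewrite black_dvec b_black. Qed.

(* The index of the white square of the rectangle that is equivalent to the
   neighbour of [b i] in direction [d]. *)
Definition white_end i d := projT1 (cid (white_rep (nb_white i d))).

Lemma white_endP i d : L (b i + dvec d - w (white_end i d)).
Proof. exact: projT2 (cid (white_rep (nb_white i d))). Qed.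

Lemma white_end_unique i d j : L (b i + dvec d - w j) -> white_end i d = j.
Proof.
move=> Lj; apply: w_lattice_inj; have := latticeB validL Lj (white_endP i d).
by rewrite opprB addrC addrA subrK.
Qed.

(** Each orbit is represented by an edge with black end [b i] itself, which is given by its
    direction. *)
Lemma joining_orbitsE i j : joining_orbits L (b i) (w j) =
  (fun d => edge_orbit L (b i, b i + dvec d)) @` [set d | white_end i d == j].
Proof.
apply/seteqP; split=> [o [e [e_edge -> [v [v' [Lv Lv' eE]]]]]|o [d /eqP om_d
  <-]].
  move: e_edge; rewrite /is_edge eE /= => /and3P[_ _ /share_sideP[d dE]].
  exists d.
    apply/eqP/white_end_unique; have := latticeB validL Lv' Lv.
    by congr L; rewrite -[in RHS](addrK v' (w j)) dE; ring.
  rewrite /edge_orbit /= dE; apply/seteqP; split=> [_ [u Lu <-]|_ [u Lu <-]] /=.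
    exists (u - v); first exact: latticeB.
    by congr (_, _); rewrite -!addrA; ring.
  exists (v + u); first exact: latticeD.
  by congr (_, _); rewrite -!addrA; ring.
exists (b i, b i + dvec d); split=> //.
  by rewrite /is_edge /= b_black nb_white; apply/share_sideP; exists d.
exists 0, (b i + dvec d - w j); split; first exact: lattice0.
  by rewrite -om_d; apply: white_endP.
by rewrite addr0 [w j + _]addrC subrK.
Qed.

Lemma kasteleyn_entry i j : kasteleyn L x0 x1 y1 b w i j =
  \sum_(d | white_end i d == j) orbit_weight x0 x1 y1 (edge_orbit L (b i, b i +
    dvec d)).
Proof.
(* Distinct directions give distinct orbits: a translation that fixes [b i] is zero. *)
rewrite mxE joining_orbitsE fsbig_image; last first.
  move=> d d' _ _ /seteqP[/(_ (b i, b i + dvec d)) sub _].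
  have [|v Lv e] := sub; first by exists 0; [apply: lattice0|rewrite !addr0].
  have v0 : v = 0 by apply: (addrI (b i)); rewrite addr0 -[RHS](congr1 fst e).
  have : b i + dvec d' + v = b i + dvec d := congr1 snd e.
  by rewrite v0 addr0 => /addrI /dvec_inj ->.
rewrite -[RHS]big_filter.
have -> : [set d | white_end i d == j] =
    [set` [seq d <- index_enum (bool * bool)%type | white_end i d == j]].
  by apply/seteqP; split=> d /=; rewrite mem_filter mem_index_enum andbT.
by rewrite -fsbig_seq // filter_uniq // index_enum_uniq.
Qed.

(** Along a negated step the white square lies to the left or below, so the white end is the
    tail. *)
Definition tail_square i (d : direction) := if d.2 then w (white_end i d) else
  b i.
Definition head_square i (d : direction) := if d.2 then b i else w (white_end i
  d).

Lemma tail_rect i d : rectangle x0 y1 (tail_square i d).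
Proof. by rewrite /tail_square; case: ifP => _;
  [apply: w_rect|apply: b_rect]. Qed.

Lemma head_rect i d : rectangle x0 y1 (head_square i d).
Proof. by rewrite /head_square; case: ifP => _;
  [apply: b_rect|apply: w_rect]. Qed.

Lemma low_tail i d : L (low_square (b i) d - tail_square i d).
Proof.
rewrite /low_square /tail_square; case: ifP => _; first exact: white_endP.
by rewrite subrr; apply: lattice0.
Qed.

Lemma high_head i d : L (high_square (b i) d - head_square i d).
Proof.
rewrite /high_square /head_square; case: ifP => _; last exact: white_endP.
by rewrite subrr; apply: lattice0.
Qed.

Lemma tail_head_step i d : L (tail_square i d + unit_vec d.1 - head_square i d).
Proof.
have := latticeB validL (high_head i d) (low_tail i d).
rewrite high_low_square; congr L; ring.
Qed.

Lemma vertical_tail_head i (d : direction) : d.1 ->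
  head_square i d = (if (tail_square i d).2 == y1%:Z - 1 then
         if x1%:Z <= (tail_square i d).1 then (tail_square i d).1 - x1%:Z
         else (tail_square i d).1 + x0%:Z - x1%:Z
       else (tail_square i d).1,
     if (tail_square i d).2 == y1%:Z - 1 then 0 else (tail_square i d).2 + 1).
Proof.
move=> d1; apply: (vertical_head validL basisL); try exact: tail_rect.
  exact: head_rect.
by have := tail_head_step i d; rewrite d1.
Qed.

Lemma horizontal_tail_head i (d : direction) : ~~ d.1 ->
  head_square i d = (if (tail_square i d).1 == x0%:Z - 1 then 0 else
    (tail_square i d).1 + 1,
              (tail_square i d).2).
Proof.
move=> /negPf d1; apply: (horizontal_head validL basisL); try exact: tail_rect.
  exact: head_rect.
by have := tail_head_step i d; rewrite d1.
Qed.

(** The path u(0) is the bottom side of the rectangle, so a crossing edge has its upper square in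
    the bottom row, which means that its tail is reduced to the top row. *)
Lemma crossing_u0 i d :
  `[< exists2 e, edge_orbit L (b i, b i + dvec d) e & crosses (path_u0 x0) e >]
    =
  d.1 && ((tail_square i d).2 == y1%:Z - 1).
Proof.
have -> : d.1 && ((tail_square i d).2 == y1%:Z - 1) = d.1 && ((head_square i
  d).2 == 0).
  case d1: d.1 => //=; rewrite vertical_tail_head //=; case: eqP => //.
  by have [_] := tail_rect i d; case: (tail_square i d) => a c /=; lia.
have high_v v : high_square (b i + v) d = high_square (b i) d + v.
  by rewrite /high_square; case: ifP => // _; rewrite addrAC.
apply/asboolP/idP => [[_ [v Lv <-] /=]|/andP[d1 /eqP h2]].
  rewrite addrAC crosses_u0 => /and3P[-> /eqP h2 h1] /=; apply/eqP.
  rewrite -h2; congr (_.2); apply: (rectangle_unique validL basisL).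
  - exact: head_rect.
  - by split=> //; rewrite h2; have := y1_gt0 basisL; lia.
  have := latticeB validL (latticeN validL (high_head i d)) Lv.
  by rewrite high_v opprB opprD addrA.
exists (b i + (head_square i d - high_square (b i) d), b i + dvec d +
  (head_square i d - high_square (b i) d)).
  exists (head_square i d - high_square (b i) d) => //.
  by rewrite -opprB; apply: latticeN => //; apply: high_head.
rewrite addrAC crosses_u0 high_v addrC subrK d1 h2 eqxx /=.
by have [] := head_rect i d.
Qed.

(** A vertical edge crossing the horizontal part of u(1) has its lower square in the top row of the
    rectangle. A horizontal edge crossing the left side has its left square in column -1, hence its
    tail in column [x0 - 1]. *)
Lemma crossing_u1 i d :
  `[< exists2 e, edge_orbit L (b i, b i + dvec d) e &
        crosses (path_u1 x1 y1) e >] =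
  if d.1 then ((tail_square i d).2 == y1%:Z - 1) && ((tail_square i d).1 <
    x1%:Z)
  else (tail_square i d).1 == x0%:Z - 1.
Proof.
have low_v v : low_square (b i + v) d = low_square (b i) d + v.
  by rewrite /low_square; case: ifP => // _; rewrite addrAC.
have low_tail_v v : L v -> rectangle x0 y1 (low_square (b i) d + v) ->
    tail_square i d = low_square (b i) d + v.
  move=> Lv v_rect; apply: (rectangle_unique validL basisL) => //.
    exact: tail_rect.
  have := latticeB validL (latticeN validL (low_tail i d)) Lv.
  by rewrite opprB opprD addrA.
have [[a_ge a_lt] [c_ge c_lt]] : (0 <= (tail_square i d).1 /\ (tail_square i
  d).1 < x0%:Z) /\
    (0 <= (tail_square i d).2 /\ (tail_square i d).2 < y1%:Z).
  by have [/andP[? ?] /andP[? ?]] := tail_rect i d.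
have lt_x1 := x1_lt basisL; have y1_pos := y1_gt0 basisL.
apply/asboolP/idP => [[_ [v Lv <-] /=]|].
  rewrite addrAC crosses_u1 high_low_square low_v.
  move: (low_tail_v v Lv) (low_tail_v _ (latticeD validL Lv (x0_lattice
    basisL))).
  rewrite [low_square _ _ + (v + _)]addrA;
    case: (low_square (b i) d + v) => a c.
  rewrite /unit_vec; case: ifP => d1 tailE tailE'; rewrite d1.
    rewrite addr_pair /= => rect_ac; rewrite tailE /=; last by split=> /=; lia.
    by lia.
  rewrite addr_pair /= => rect_ac.
  by rewrite tailE' addr_pair; [|split] => /=; lia.
(* This translation puts the lower square on the tail, or the left square on the tail shifted by
   -v_0, just outside the left side. *)
move=> h; pose v := tail_square i d - (if d.1 then 0 else (x0%:Z, 0)) -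
  low_square (b i) d.
have Lv : L v.
  rewrite /v addrAC; apply: latticeB => //.
    by rewrite -opprB; apply: latticeN => //; apply: low_tail.
  by case: ifP => _; [apply: lattice0|apply: (x0_lattice basisL)].
exists (b i + v, b i + dvec d + v); first by exists v.
rewrite addrAC crosses_u1 high_low_square low_v [low_square _ _ + v]addrC subrK.
move: h a_ge a_lt c_ge c_lt; case: (tail_square i d) => a c.
rewrite /unit_vec; case: ifP => _; first by rewrite subr0 addr_pair /=; lia.
by rewrite subr_pair addr_pair /=; lia.
Qed.

(** The edges of sign -1: the black end is on the left. *)
Definition turn (d : direction) : bool := ~~ d.1 && ~~ d.2.
Definition cross0 i (d : direction) : bool :=
  d.1 && ((tail_square i d).2 == y1%:Z - 1).
Definition cross1 i (d : direction) : bool :=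
  if d.1 then ((tail_square i d).2 == y1%:Z - 1) && ((tail_square i d).1 <
    x1%:Z)
  else (tail_square i d).1 == x0%:Z - 1.

Lemma leval_entry i j (p q : bool) :
  leval (kasteleyn L x0 x1 y1 b w i j) ((-1) ^+ p) ((-1) ^+ q) =
  \sum_(d | white_end i d == j) (-1) ^+ (turn d + p * cross0 i d + q * cross1 i
    d)%R.
Proof.
rewrite kasteleyn_entry (big_morph _ (levalD _ _) (leval0 _ _)).
apply: eq_bigr => d _; rewrite leval_orbit_weight crossing_u0 crossing_u1.
congr ((-1) ^+ (nat_of_bool (_ + _ + _)%R)).
have subE v : b i + dvec d + v - (b i + v) = dvec d.
  by rewrite opprD addrACA subrr addr0 addrC addKr.
apply/asboolP/idP => [[_ [v Lv <-] /=]|]; rewrite /turn.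
  by rewrite subE; case: d {subE} => -[] [].
move=> d_right; exists (b i + 0, b i + dvec d + 0).
  by exists 0 => //; apply: lattice0.
by rewrite /= subE; case: d d_right {subE} => -[] [].
Qed.

Implicit Type f : {ffun 'I_m -> direction}.

(** A matching is a choice of directions and not a permutation, because on a small torus several
    edges may join the same two squares. *)
Definition matching f := injectiveb (fun i => white_end i (f i)).

Definition matching_perm f : 'S_m := odflt 1%g [pick s : 'S_m | [forall i, s i
  == white_end i (f i)]].

Lemma matching_permE f i : matching f -> matching_perm f i = white_end i (f i).
Proof.
move=> /injectiveP f_inj; rewrite /matching_perm;
  case: pickP => [s /forallP/(_ i)/eqP|] //.
by move/(_ (perm f_inj)) => /forallP[] j; rewrite permE.
Qed.

(** Expanding the products of entries gives pairs of a permutation and a compatible choice of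
    directions; the directions determine the permutation. *)
Lemma leval_det_kasteleyn (p q : bool) :
  leval (\det (kasteleyn L x0 x1 y1 b w)) ((-1) ^+ p) ((-1) ^+ q) =
  \sum_(f | matching f)
    (-1) ^+ (odd_perm (matching_perm f) + \sum_i turn (f i) +
      p * (\sum_i cross0 i (f i)) + q * (\sum_i cross1 i (f i)))%R.
Proof.
rewrite leval_det ?signr_eq0 //.
under eq_bigr do under eq_bigr do rewrite leval_entry.
under eq_bigr do rewrite bigA_distr_big_dep mulr_sumr.
rewrite (exchange_big_dep matching) /=; last first.
  move=> s f _ /familyP fs; apply/injectiveP => i j eq_ij.
  by apply: (@perm_inj _ s); rewrite -(eqP (fs i)) -(eqP (fs j)).
apply: eq_bigr => f f_match; rewrite (big_pred1 (matching_perm f)) => [|s].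
  rewrite prod_sign -signr_addb; congr ((-1) ^+ (nat_of_bool _)).
  rewrite !big_split /= -!mulr_sumr; move: (odd_perm _) (\sum_i turn _) (p * _)
    (q * _) => [] [] [] [] //.
apply/familyP/eqP => [fs|-> i]; last by rewrite unfold_in matching_permE.
by apply/permP => i; rewrite matching_permE //; have /eqP := fs i.
Qed.

(** * The sign of a matching in terms of its flux *)

Definition spos (s : square) := (`|s.2| * x0 + `|s.1|)%N.

Lemma rect_absP s : rectangle x0 y1 s ->
  [/\ (`|s.1| < x0)%N, (`|s.2| < y1)%N, s = (`|s.1|%:Z, `|s.2|%:Z) &
      odd (`|s.1| + `|s.2|)%N = ~~ black s].
Proof.
case: s => a c [/= a_rect c_rect]; rewrite /black /=; split; try by lia.
by congr (_, _); lia.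
Qed.

Lemma rect_abs_inj s t : rectangle x0 y1 s -> rectangle x0 y1 t ->
  `|s.1|%N = `|t.1|%N -> `|s.2|%N = `|t.2|%N -> s = t.
Proof. by move=> /rect_absP[_ _ -> _] /rect_absP[_ _ -> _] /= -> ->. Qed.

Lemma spos_inj s t : rectangle x0 y1 s -> rectangle x0 y1 t -> spos s = spos t
  -> s = t.
Proof.
move=> s_rect t_rect eq_st; have [s1 _ _ _] := rect_absP s_rect.
have [t1 _ _ _] := rect_absP t_rect.
have := ltn_pos `|s.2| `|t.2| s1 t1; have := ltn_pos `|t.2| `|s.2| t1 s1.
rewrite -/(spos s) -/(spos t) eq_st ltnn => h1 h2.
by apply: rect_abs_inj => //; lia.
Qed.

(** Each square of the rectangle occurs exactly once among the [b i] and [w i]; both sides are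
    compared through point indicators. *)
Lemma rectangle_sum (F : nat -> nat -> bool) :
  \sum_(y < y1) \sum_(x < x0) F x y =
  \sum_i F `|(b i).1|%N `|(b i).2|%N + \sum_i F `|(w i).1|%N `|(w i).2|%N.
Proof.
have point (s : square) : rectangle x0 y1 s -> F `|s.1|%N `|s.2|%N =
    \sum_(y < y1) \sum_(x < x0) (s == (x%:Z, y%:Z)) * F x y.
  move=> /rect_absP[s1 s2 sE _]; rewrite (bigD1 (Ordinal s2)) //=.
  rewrite (bigD1 (Ordinal s1)) //= -sE eqxx big1 => [|x neq_x].
    rewrite big1 ?addr0 => [|y neq_y]; first by case: (F _ _).
    rewrite big1 // => x _; rewrite [s in s == _]sE xpair_eqE.
    have -> : (`|s.2|%:Z == y%:Z) = false; last by rewrite andbF.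
    by apply: contra_neqF neq_y => /eqP[e]; apply: val_inj.
  rewrite [s in s == _]sE xpair_eqE.
  have -> : (`|s.1|%:Z == x%:Z) = false => //.
  by apply: contra_neqF neq_x => /eqP[e]; apply: val_inj.
have count (s : square) : rectangle x0 y1 s ->
    \sum_i (b i == s) + \sum_i (w i == s) = 1.
  move=> s_rect; case: (boolP (black s)) => s_col.
    have [i _ si] := set_bij_surj b_bij (conj s_rect s_col).
    rewrite [X in _ + X]big1 => [|j _]; last first.
      by apply: contraNF (w_white j) => /eqP ->.
    rewrite (bigD1 i) //= si eqxx big1 // => j neq_ji.
    by rewrite -si; apply: contra_neqF neq_ji => /eqP/b_inj.
  have [i _ si] := set_bij_surj w_bij (conj s_rect s_col).
  rewrite big1 => [|j _]; last first.
    by apply: contraNF s_col => /eqP <-; apply: b_black.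
  rewrite (bigD1 i) //= si eqxx big1 // => j neq_ji.
  by rewrite -si; apply: contra_neqF neq_ji => /eqP/w_inj.
rewrite (eq_bigr _ (fun i _ => point _ (b_rect i))).
rewrite [X in _ + X](eq_bigr _ (fun i _ => point _ (w_rect i))).
rewrite [X in _ = X + _]exchange_big [X in _ = _ + X]exchange_big -big_split;
  apply: eq_bigr => y _.
rewrite [X in _ = X + _]exchange_big [X in _ = _ + X]exchange_big -big_split;
  apply: eq_bigr => x _.
rewrite /= -!mulr_suml -mulrDl count ?mul1r //.
by split=> /=; have := ltn_ord x; have := ltn_ord y; lia.
Qed.

Lemma matching_parity : exists c C : bool, forall f, matching f ->
  odd_perm (matching_perm f) + \sum_i turn (f i) =
  c + C * (\sum_i cross0 i (f i)) + \sum_i cross1 i (f i) +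
  (\sum_i cross0 i (f i)) * (\sum_i cross1 i (f i)).
Proof.
have [||| c c_perm] := @odd_perm_crossings m (spos \o b) (spos \o w).
- by move=> i j /= /spos_inj e; apply: b_inj; apply: e; apply: b_rect.
- by move=> i j /= /spos_inj e; apply: w_inj; apply: e; apply: w_rect.
- move=> i j; apply/eqP => /= /spos_inj e.
  by have := w_white j; rewrite -e ?b_black //; [apply: b_rect|apply: w_rect].
(* [c] depends only on the two enumerations, and the second constant is the coefficient of [flux0]
   in [kasteleyn_parity]. *)
exists c, (colour_const y1 + \sum_(y < y1) (y != y1.-1 :> nat)) => f f_match.
have f_inj : injective (fun i => white_end i (f i)) by apply/injectiveP.
pose t i := tail_square i (f i); pose h i := head_square i (f i).
have t_rect i : rectangle x0 y1 (t i) by apply: tail_rect.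
have h_rect i : rectangle x0 y1 (h i) by apply: head_rect.
have parity := @kasteleyn_parity m x0 x1 y1 (fun i => `|(t i).1|%N)
  (fun i => `|(t i).2|%N) (fun i => `|(h i).1|%N) (fun i => `|(h i).2|%N)
  (fun i => (f i).1) (x0_even validL basisL) (x1_lt basisL)
  (odd_x1_y1 validL basisL).
have flux0E : flux0 y1 (fun i => `|(t i).2|%N) (fun i => (f i).1) =
    \sum_i cross0 i (f i).
  rewrite /flux0 big_mkcond; apply: eq_bigr => i _; rewrite /cross0 /at_top.
  have := y1_gt0 basisL; have [_] := t_rect i; rewrite -/(t i).
  by case: (t i) => t1 t2 /=; case: ifP => //= _; lia.
have flux1E : wraps x0 (fun i => `|(t i).1|%N) (fun i => (f i).1) +
    topleft x1 y1 (fun i => `|(t i).1|%N) (fun i => `|(t i).2|%N) (fun i => (f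
      i).1) =
    \sum_i cross1 i (f i).
  rewrite /wraps /topleft [in RHS](bigID (fun i => (f i).1)) addrC.
  congr (_ + _); apply: eq_bigr => i Vi; rewrite /cross1 /at_top /at_right.
    have := y1_gt0 basisL; have [] := t_rect i; rewrite -/(t i) Vi.
    by case: (t i) => t1 t2 /=; rewrite -[GRing.mul _ _]/(_ && _); lia.
  have := x0_gt0 basisL; have [] := t_rect i; rewrite -/(t i) (negPf Vi).
  by case: (t i) => t1 t2 /=; lia.
rewrite flux0E flux1E in parity.
rewrite (c_perm (matching_perm f)) -!addrA; congr (_ + _); rewrite !addrA.
apply: (parity _ _ _ _ _ _ _ _ (spos \o b) (fun i => spos (w (matching_perm f
  i)))
  (fun i => (f i).2)).
- by move=> i; have [] := rect_absP (t_rect i).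
- by move=> i; have [] := rect_absP (t_rect i).
- move=> i Vi; have [h1 h2 _ _] := rect_absP (t_rect i).
  move: h1 h2 (t_rect i); have := vertical_tail_head i Vi.
  rewrite /at_top -/(t i) -/(h i) => ->; have := x1_lt basisL.
  by case: (t i) => u v lt_x1 /= h1 h2 [/= u_lt v_lt]; split; do !case: ifP;
    lia.
- move=> i Vi; have [h1 h2 _ _] := rect_absP (t_rect i).
  move: h1 h2 (t_rect i); have := horizontal_tail_head i Vi.
  rewrite /at_right -/(t i) -/(h i) => ->.
  by case: (t i) => u v /= h1 h2 [/= u_lt v_lt]; split=> //; do !case: ifP; lia.
(* Reindexing the white squares by the matching puts both ends of each domino under one index. *)
- move=> F; rewrite rectangle_sum big_split /=.
  rewrite [X in _ = _ + X](reindex_inj (@perm_inj _ (matching_perm f)))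
    -!big_split /=.
  apply: eq_bigr => i _; rewrite matching_permE // /t /h /tail_square
    /head_square.
  by case: ifP => // _; apply: addrC.
- move=> i j e1 e2; have := rect_abs_inj (t_rect i) (t_rect j) e1 e2.
  rewrite /t /tail_square; case: ifP => _; case: ifP => _.
  + by move/w_inj/f_inj.
  + by move=> e; have := w_white (white_end i (f i)); rewrite e b_black.
  + by move=> e; have := w_white (white_end j (f j)); rewrite -e b_black.
  + exact: b_inj.
- move=> i j e1 e2; have := rect_abs_inj (h_rect i) (h_rect j) e1 e2.
  rewrite /h /head_square; case: ifP => _; case: ifP => _.
  + exact: b_inj.
  + by move=> e; have := w_white (white_end j (f j)); rewrite -e b_black.
  + by move=> e; have := w_white (white_end i (f i)); rewrite e b_black.
  + by move/w_inj/f_inj.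
(* A tail and a head of the same colour could only coincide for [i = j], against the orientation of
   the arc. *)
- move=> i j e1 e2; have := rect_abs_inj (t_rect i) (h_rect j) e1 e2.
  rewrite /t /h /tail_square /head_square; case: ifP => fi; case: ifP => fj.
  + by move=> e; have := w_white (white_end i (f i)); rewrite e b_black.
  + by move/w_inj/f_inj => e; rewrite e fj in fi.
  + by move/b_inj => e; rewrite e fj in fi.
  + by move=> e; have := w_white (white_end j (f j)); rewrite -e b_black.
- move=> i; rewrite /tpos /hpos /t /h /tail_square /head_square matching_permE
  //=.
  by case: ifP.
- move=> i _; have [_ _ _ ->] := rect_absP (t_rect i).
  by rewrite /t /tail_square; case: ifP; rewrite ?w_white ?b_black.
Qed.

(** * Tilings of the torus as matchings *)

Definition tile i (d : direction) v : set square :=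
  [set b i + v; b i + dvec d + v].

Definition tiles f : set (set square) :=
  [set D | exists i v, L v /\ D = tile i (f i) v].

Lemma tile_black i d v s : L v -> black s -> tile i d v s -> s = b i + v.
Proof.
move=> Lv s_black [//|e]; move: s_black.
by rewrite e (black_lattice validL _ Lv) (negPf (nb_white i d)).
Qed.

Lemma tile_white i d v s : L v -> ~~ black s -> tile i d v s ->
  s = b i + dvec d + v.
Proof.
move=> Lv s_white [e|//]; move: s_white.
by rewrite e (black_lattice validL _ Lv) b_black.
Qed.

Lemma white_end_eq i d j d' : white_end i d = white_end j d' ->
  L (b i + dvec d - (b j + dvec d')).
Proof.
move=> eq_om; have := latticeB validL (white_endP i d) (white_endP j d').
by rewrite eq_om; congr L; ring.
Qed.

Lemma translate_tile i d u v : translate u (tile i d v) = tile i d (v + u).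
Proof. by rewrite /translate /tile image_setU !image_set1 !addrA. Qed.

(** A common square of two dominoes identifies them, by [b] if it is black and by injectivity of the
    matching if it is white. White squares are covered because the matching is onto. *)
Lemma tiles_tiling f : matching f -> torus_tilings L (tiles f).
Proof.
move=> f_match; have f_inj : injective (fun i => white_end i (f i)) by
  apply/injectiveP.
split; last first.
  move=> u _ Lu [i [v [Lv ->]]]; exists i, (v + u); split;
    first exact: latticeD.
  exact: translate_tile.
split.
- move=> _ [i [v [Lv ->]]]; exists (b i + v), (b i + dvec (f i) + v);
  split=> //.
  by apply/share_sideP; exists (f i); rewrite addrAC.
- move=> _ _ [i [v [Lv ->]]] [j [u [Lu ->]]] [s [si sj]].
  have [s_black|s_white] := boolP (black s).
    have := tile_black Lv s_black si; rewrite (tile_black Lu s_black sj) => e.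
    have eq_ij : i = j.
      apply: b_lattice_inj; have := latticeB validL Lu Lv; congr L.
      by rewrite -(addrK v (b i)) -e; ring.
    by rewrite eq_ij in e *; rewrite (addrI _ e).
  have := tile_white Lv s_white si; rewrite (tile_white Lu s_white sj) => e.
  have eq_ij : i = j.
    apply/f_inj/white_end_unique; have := latticeD validL (latticeB validL Lu
      Lv) (white_endP j (f j)).
    congr L; rewrite -(addrK v (b i + dvec (f i))) -e; ring.
  by rewrite eq_ij in e *; rewrite (addrI _ e).
- apply/seteqP; split=> // s _.
  have [s_black|s_white] := boolP (black s).
    have [i Li] := black_rep s_black; exists (tile i (f i) (s - b i)).
      by exists i, (s - b i).
    by left; rewrite addrC subrK.
  have [j Lj] := white_rep s_white; pose g := matching_perm f;
    pose i := (g^-1)%g j.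
  have om_i : white_end i (f i) = j by rewrite -matching_permE // permKV.
  have Lu : L (s - (b i + dvec (f i))).
    have := latticeB validL Lj (white_endP i (f i)); rewrite om_i; congr L;
      ring.
  exists (tile i (f i) (s - (b i + dvec (f i)))).
    by exists i, (s - (b i + dvec (f i))).
  by right; rewrite /= [RHS]addrC subrK.
Qed.

(** The direction [f i] is read off from the domino that covers [b i]. *)
Lemma tiles_inj f g : tiles f = tiles g -> f = g.
Proof.
move=> eq_fg; apply/ffunP => i.
have : tiles f (tile i (f i) 0) by exists i, 0; split=> //; apply: lattice0.
rewrite eq_fg => -[j [v [Lv eq_tile]]].
have bi : tile j (g j) v (b i) by rewrite -eq_tile; left; rewrite addr0.
have e := tile_black Lv (b_black i) bi.
have eq_ij : i = j by apply: b_lattice_inj; rewrite e addrC addKr.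
have v0 : v = 0 by apply: (addrI (b j)); rewrite -e eq_ij addr0.
have nb : tile j (g j) v (b i + dvec (f i)).
  by rewrite -eq_tile; right; rewrite addr0.
have := tile_white Lv (nb_white i (f i)) nb.
by rewrite v0 addr0 -eq_ij => /addrI /dvec_inj.
Qed.

Lemma domino_through s D : is_domino D -> D s ->
  exists d : direction, D = [set s; s + dvec d].
Proof.
case=> u [v [/share_sideP[d ->] ->]] [->|->]; first by exists d.
exists (d.1, ~~ d.2); rewrite setUC; congr ([set _; _]).
by case: d => o []; rewrite /dvec /= ?subrK ?addrK.
Qed.

(** The dominoes at the squares [b i] give [f], and periodicity gives all the others. *)
Lemma tiles_surj T : torus_tilings L T -> exists2 f, matching f & T = tiles f.
Proof.
move=> [[T_domino T_disj T_cover] T_periodic].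
have tile_at s : exists2 D, T D & D s.
  by have : setT s by []; rewrite -T_cover => -[D]; exists D.
have T_unique D D' s : T D -> T D' -> D s -> D' s -> D = D'.
  by move=> TD TD' Ds D's; apply: T_disj => //; exists s.
have /choice[f0 Tf0] : forall i, exists d : direction, T (tile i d 0).
  move=> i; have [D TD Di] := tile_at (b i).
  have [d DE] := domino_through (T_domino D TD) Di; exists d.
  by rewrite /tile !addr0 -DE.
pose f := [ffun i => f0 i].
have Tf i v : L v -> T (tile i (f i) v).
  by move=> Lv; rewrite ffunE -[v]add0r -translate_tile; apply: T_periodic.
exists f.
  (* Equal white ends make the domino of [i] share a white square with the translate by [v] of that
     of [j], so both are one domino with one black square. *)
  apply/injectiveP => i j /white_end_eq Lij; set v := _ - _ in Lij.
  have ij : tile i (f i) 0 = tile j (f j) v.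
    apply: (T_unique _ _ (b i + dvec (f i))); try apply: Tf => //.
    - exact: lattice0.
    - by right; rewrite addr0.
    - by right; rewrite /= [RHS]addrC subrK.
  have bi : tile j (f j) v (b i) by rewrite -ij; left; rewrite addr0.
  by apply: b_lattice_inj; rewrite (tile_black Lij (b_black i) bi) addrC addKr.
apply/seteqP; split=> [D TD|_ [i [v [Lv ->]]]]; last exact: Tf.
have [s s_black Ds] : exists2 s, black s & D s.
  have [s [t [/share_sideP[d ->] ->]]] := T_domino D TD.
  have [s_black|s_white] := boolP (black s); first by exists s => //; left.
  by exists (s + dvec d); [rewrite black_dvec|right].
have [i Li] := black_rep s_black; exists i, (s - b i); split=> //.
apply: (T_unique _ _ s) => //; first exact: Tf.
by left; rewrite addrC subrK.
Qed.

Lemma card_torus_tilings : (torus_tilings L #= `I_#|matching|)%card.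
Proof.
pose f0 : {ffun 'I_m -> direction} := [ffun=> (false, false)].
pose g k := tiles (nth f0 (enum matching) k).
have -> : torus_tilings L = g @` `I_#|matching|.
  apply/seteqP; split=> [T /tiles_surj[f f_match ->]|_ [k lt_k <-]].
    exists (index f (enum matching)); last by rewrite /g nth_index ?mem_enum.
    by rewrite /= cardE index_mem mem_enum.
  apply: tiles_tiling; have : nth f0 (enum matching) k \in enum matching.
    by rewrite mem_nth // -cardE.
  by rewrite mem_enum.
apply: inj_card_eq => k l; rewrite !inE /= !cardE => lt_k lt_l /tiles_inj/eqP.
by rewrite nth_uniq ?enum_uniq // => /eqP.
Qed.

End KasteleynEntries.

(** * The signed sum of the four evaluations *)

Theorem proposition8p3p5 (L : set (int * int)) (x0 x1 y1 m : nat)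
    (b w : 'I_m -> square) :
  valid_lattice L ->
  lattice_basis L x0 x1 y1 ->
  set_bij [set: 'I_m] [set s | rectangle x0 y1 s /\ black s] b ->
  set_bij [set: 'I_m] [set s | rectangle x0 y1 s /\ ~~ black s] w ->
  let pK : laurent := \det (kasteleyn L x0 x1 y1 b w) in
  exists s00 s01 s10 s11 : rat,
    [/\ s00 \in [:: 2^-1; - 2^-1], s01 \in [:: 2^-1; - 2^-1],
        s10 \in [:: 2^-1; - 2^-1] & s11 \in [:: 2^-1; - 2^-1]] /\
    exists N : nat,
      (torus_tilings L #= `I_N)%card /\
      N%:R = s00 * leval pK 1 1 + s01 * leval pK 1 (-1)
           + s10 * leval pK (-1) 1 + s11 * leval pK (-1) (-1).
Proof.
move=> validL basisL b_bij w_bij pK.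
have [c [C parity]] := matching_parity validL basisL b_bij w_bij.
have levalE (p q : bool) := leval_det_kasteleyn validL basisL b_bij w_bij p q.
(* These signs let each matching contribute 1. With fluxes a and b, the exponent of -1 in the term
   of [(p, q)] contains p (1 + q + a), so summing over p leaves q = 1 + a only; there all other
   signs cancel and two terms 1/2 remain. *)
pose s (p q : bool) : rat := (-1) ^+ (c + (p + C) * ~~ q)%R * 2^-1.
have s_half p q : s p q \in [:: 2^-1; - 2^-1].
  by rewrite /s !inE; case: (_ + _); rewrite ?mul1r ?mulN1r eqxx ?orbT.
exists (s false false), (s false true), (s true false), (s true true).
split; first by split; apply: s_half.
exists #|matching validL basisL b_bij w_bij|; split.
  exact: card_torus_tilings.
rewrite (levalE false false : leval pK 1 1 = _).
rewrite (levalE false true : leval pK 1 (-1) = _).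
rewrite (levalE true false : leval pK (-1) 1 = _).
rewrite (levalE true true : leval pK (-1) (-1) = _).
rewrite !mulr_sumr -!big_split /= -sum1_card natr_sum.
apply: eq_bigr => f f_match; rewrite parity //.
move: (\sum_i cross0 _ _ _ _ i _) (\sum_i cross1 _ _ _ _ i _) => F0 F1.
rewrite /s => {s s_half parity}; by case: c; case: C; case: F0; case: F1.
Qed.
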